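(* Let $k$ be a field, $n\ge 1$, $R=k[x_1,\ldots,x_n]$, let $a,b$ be integers with $b>0$ and $a>2b$, and let $I=(x_1^a,\ldots,x_n^a,(x_1\cdots x_n)^b)\subset R$. Let $\mathcal I\subset S=R[y_1,\ldots,y_n,w]$ be the presentation ideal of the Rees algebra of $I$ and let $r$ be the reduction number of $I$ (as specified in the context). Then: (a) $\mathcal I$ is generated by $$\binom n2+\sum_{\delta=1}^r\binom n\delta+1$$ quasi-homogeneous binomials; of these, $\binom n2$ are the Koszul syzygies $K_{i,j}=x_i^ay_j-x_j^ay_i$, $1\le i<j\le n$, and the remaining ones are each a binomial of the form $$(x_{i_1}\cdots x_{i_\delta})^{a-\delta b}\,w^\delta-P(i_1,\ldots,i_\delta)^{\delta b}\,y_{i_1}\cdots y_{i_\delta},$$ with $1\le i_1<\cdots<i_\delta\le n$ and $1\le\delta\le r+1$, with the convention that if $a\le nb$ and $\delta=r+1$ the binomial is to be read as $w^{\delta}-P(i_1,\ldots,i_\delta)^{\delta b}(x_{i_1}\cdots x_{i_\delta})^{\delta b-a}y_{i_1}\cdots y_{i_\delta}$. (b) Each of the binomials in (a) is a Sylvester form obtained iteratively out of the syzygy forms. (c) The relation type of $I$ is $r+1$.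
   Context: The presentation ideal is $\mathcal I=\ker(S\to R[It])$, $y_j\mapsto x_j^a t$, $w\mapsto(x_1\cdots x_n)^bt$. For $\{i_1,\ldots,i_j\}\subset\{1,\ldots,n\}$, $P(i_1,\ldots,i_j)$ is the product of the variables in $\{x_1,\ldots,x_n\}\setminus\{x_{i_1},\ldots,x_{i_j}\}$. Reduction number: if $a\le nb$, let $1\le p\le n$ be the unique integer with $(p-1)b<a\le pb$; then $J=(x_1^a,\ldots,x_n^a)$ is a minimal reduction of $I$ and $r={\rm red}_J(I)=p-1$. If $a>nb$, then $Q=(x_1^a-x_n^a,\ldots,x_{n-1}^a-x_n^a,(x_1\cdots x_n)^b)$ is a minimal reduction of $I$ and $r={\rm red}_Q(I)=n-1$. (This is a known result.) Quasi-homogeneous means homogeneous in the weighted grading of $S$ over $k$ with $\deg x_i=1$ for all $i$ and: $\deg w=nb-a+1$, $\deg y_j=1$ if $a\le nb$; $\deg w=1$, $\deg y_j=a-nb+1$ if $a> nb$. The syzygy forms are $K_{i,j}=x_i^ay_j-x_j^ay_i$ ($i<j$) and $L_i=x_i^{a-b}w-P(i)^by_i$ ($1\le i\le n$). If $f,g\in S$ both belong to the ideal $(u,v)S$, where $\{u,v\}\subset R$ is a complete intersection (regular sequence), and $M$ is a $2\times2$ matrix over $S$ with $\begin{pmatrix}f\\ g\end{pmatrix}=M\begin{pmatrix}u\\ v\end{pmatrix}$ (a Sylvester content matrix), then $\det M$ is called a Sylvester form of $f,g$ with respect to $\{u,v\}$. ''Obtained iteratively out of the syzygy forms'' means: belonging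 to the smallest set of polynomials containing the syzygy forms and closed under forming Sylvester forms of pairs of its members. The external degree is the degree in the standard grading of $S$ over $R$ ($y_1,\ldots,y_n,w$ of degree $1$); the relation type of $I$ is the largest external degree of an element of a minimal set of generators of $\mathcal I$ that are homogeneous for the external grading. *)

(* Defs.v *)
From HB Require Import structures.
From mathcomp Require Import all_boot all_order all_algebra.
From mathcomp Require Import mpoly.

Set Implicit Arguments.
Unset Strict Implicit.
Unset Printing Implicit Defensive.

Import GRing.Theory.
Local Open Scope ring_scope.

(* Ideals are Prop-valued predicates. *)
Definition ideal_gen (A : comNzRingType) (G : A -> Prop) (f : A) : Prop :=
  exists s : seq (A * A),
    (forall c, c \in s -> G c.2) /\ f = \sum_(c <- s) c.1 * c.2.

Definition ideal_eq (A : comNzRingType) (J1 J2 : A -> Prop) : Prop :=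
  forall f, J1 f <-> J2 f.

Definition ideal_mul (A : comNzRingType) (J1 J2 : A -> Prop) : A -> Prop :=
  ideal_gen (fun h => exists f g, [/\ J1 f, J2 g & h = f * g]).

Fixpoint ideal_exp (A : comNzRingType) (J : A -> Prop) (m : nat) : A -> Prop :=
  if m is m'.+1 then ideal_mul J (ideal_exp J m') else fun _ => True.

Definition generates (A : comNzRingType) (J : A -> Prop) (G : seq A) : Prop :=
  ideal_eq J (ideal_gen (fun g => g \in G)).

(* red_J(I) = r : the least r with I^(r+1) = J I^r. *)
Definition reduction_number (A : comNzRingType) (J I : A -> Prop) (r : nat) :=
  ideal_eq (ideal_exp I r.+1) (ideal_mul J (ideal_exp I r)) /\
  forall s, (s < r)%N ->
    ~ ideal_eq (ideal_exp I s.+1) (ideal_mul J (ideal_exp I s)).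

(* R = k[x_1..x_n]; S = R[y_1..y_n, w], where w is the last of the n+1
   variables over R. *)
Notation polyR k n := {mpoly k[n]}.
Notation polyS k n := {mpoly {mpoly k[n]}[n.+1]}.

Definition xvar (k : fieldType) n (i : 'I_n) : polyR k n := 'X_i.
Definition yvar (k : fieldType) n (i : 'I_n) : polyS k n := 'X_(lift ord_max i).
Definition wvar (k : fieldType) n : polyS k n := 'X_ord_max.

Definition xprod (k : fieldType) n (T : {set 'I_n}) : polyR k n :=
  \prod_(i in T) xvar k i.
Definition yprod (k : fieldType) n (T : {set 'I_n}) : polyS k n :=
  \prod_(i in T) yvar k i.
(* P(i_1, ..., i_j) for T = {i_1, ..., i_j} *)
Definition Pprod (k : fieldType) n (T : {set 'I_n}) : polyR k n :=
  \prod_(i in ~: T) xvar k i.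

(* The image of the j-th variable of S, up to the factor t: x_j^a for the
   y-variables and (x_1...x_n)^b for w. *)
Definition I_gens (k : fieldType) n (a b : nat) (j : 'I_n.+1) : polyR k n :=
  if unlift ord_max j is Some i then xvar k i ^+ a else xprod k [set: 'I_n] ^+ b.

Definition idealI (k : fieldType) n (a b : nat) : polyR k n -> Prop :=
  ideal_gen (fun g => exists j : 'I_n.+1, g = I_gens k a b j).
Arguments idealI k n a b _ : clear implicits.

Definition idealJ (k : fieldType) n (a : nat) : polyR k n -> Prop :=
  ideal_gen (fun g => exists i : 'I_n, g = xvar k i ^+ a).
Arguments idealJ k n a _ : clear implicits.

(* In the first disjunct l is the last index and i ranges over the others. *)
Definition idealQ (k : fieldType) n (a b : nat) : polyR k n -> Prop :=
  ideal_gen (fun g =>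
    (exists i l : 'I_n,
       [/\ l.+1 = n, (i < l)%N & g = xvar k i ^+ a - xvar k l ^+ a])
    \/ g = xprod k [set: 'I_n] ^+ b).
Arguments idealQ k n a b _ : clear implicits.

Definition min_reduction (k : fieldType) n (a b : nat) : polyR k n -> Prop :=
  if (a <= n * b)%N then idealJ k n a else idealQ k n a b.
Arguments min_reduction k n a b _ : clear implicits.

(* R[It] is a subring of R[t] = {poly R}, so the presentation ideal is the
   kernel of the R-algebra map S -> R[t]. *)
Definition rees_map (k : fieldType) n (a b : nat) (f : polyS k n) :
    {poly polyR k n} :=
  mmap (@polyC (polyR k n)) (fun j => I_gens k a b j *: 'X) f.

Definition presentation_ideal (k : fieldType) n (a b : nat)
    (f : polyS k n) : Prop :=
  rees_map a b f = 0.
Arguments presentation_ideal k n a b f : clear implicits.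

Definition koszul (k : fieldType) n (a : nat) (i j : 'I_n) : polyS k n :=
  xvar k i ^+ a *: yvar k j - xvar k j ^+ a *: yvar k i.

Definition Lform (k : fieldType) n (a b : nat) (i : 'I_n) : polyS k n :=
  xvar k i ^+ (a - b) *: wvar k n - Pprod k [set i] ^+ b *: yvar k i.

Definition koszul_list (k : fieldType) n (a : nat) : seq (polyS k n) :=
  [seq koszul k a p.1 p.2 | p <- enum [pred p : 'I_n * 'I_n | (p.1 < p.2)%N]].

(* The binomial attached to T = {i_1 < ... < i_delta}, delta = #|T|. *)
Definition Fform (k : fieldType) n (a b r : nat) (T : {set 'I_n}) : polyS k n :=
  if (a <= n * b)%N && (#|T| == r.+1) then
    wvar k n ^+ #|T|
    - (Pprod k T ^+ (#|T| * b) * xprod k T ^+ (#|T| * b - a)) *: yprod k T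
  else
    xprod k T ^+ (a - #|T| * b) *: wvar k n ^+ #|T|
    - Pprod k T ^+ (#|T| * b) *: yprod k T.

Definition binomial_poly (k : fieldType) n (f : polyS k n) : Prop :=
  exists (u v : 'X_{1..n}) (u' v' : 'X_{1..n.+1}),
    (u, u') != (v, v') /\ f = 'X_[u] *: 'X_[u'] - 'X_[v] *: 'X_[v'].

(* The weights of y_1..y_n and w; the subtractions are not truncated. *)
Definition quasi_weight n (a b : nat) (j : 'I_n.+1) : nat :=
  if unlift ord_max j is Some _
  then (if (a <= n * b)%N then 1 else a - n * b + 1)%N
  else (if (a <= n * b)%N then n * b - a + 1 else 1)%N.

Definition quasi_homogeneous (k : fieldType) n (a b : nat)
    (f : polyS k n) : Prop :=
  exists d : nat, forall (m' : 'X_{1..n.+1}) (m : 'X_{1..n}),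
    (f@_m')@_m != 0 ->
    (mdeg m + \sum_(j < n.+1) m' j * quasi_weight a b j)%N = d.

Definition regular_pair (A : comNzRingType) (u v : A) : Prop :=
  [/\ forall h, u * h = 0 -> h = 0,
      forall h c, v * h = u * c -> exists c', h = u * c'
    & ~ exists c d, c * u + d * v = 1].

Definition colvec2 (A : comNzRingType) (f g : A) : 'cV[A]_2 :=
  \col_(i < 2) (if i == ord0 then f else g).

Definition sylvester_form (k : fieldType) n (f g : polyS k n)
    (u v : polyR k n) (h : polyS k n) : Prop :=
  regular_pair u v /\
  exists M : 'M[polyS k n]_2,
    colvec2 f g = M *m colvec2 u%:MP v%:MP /\ h = \det M.

Inductive iterated_sylvester (k : fieldType) n (a b : nat) :
    polyS k n -> Prop :=
| IterKoszul (i j : 'I_n) : (i < j)%N -> iterated_sylvester a b (koszul k a i j)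
| IterL (i : 'I_n) : iterated_sylvester a b (Lform k a b i)
| IterSylvester (f g : polyS k n) (u v : polyR k n) (h : polyS k n) :
    iterated_sylvester a b f -> iterated_sylvester a b g ->
    sylvester_form f g u v h -> iterated_sylvester a b h.

(* Minimality is with respect to inclusion of the generating set; the grading
   is the standard grading of S over R. *)
Definition min_homog_gens (k : fieldType) n (J : polyS k n -> Prop)
    (G : seq (polyS k n)) : Prop :=
  [/\ forall g, g \in G -> exists d, g \is d.-homog,
      generates J G
    & forall G' : seq (polyS k n),
        {subset G' <= G} -> generates J G' -> {subset G <= G'}].

Definition ext_degree (k : fieldType) n (f : polyS k n) : nat := (msize f).-1.

(* Asserts both that such generating sets exist and that the largest degree
   does not depend on the choice of one. *)
Definition relation_type (k : fieldType) n (J : polyS k n -> Prop) (d : nat) :=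
  (exists G, min_homog_gens J G) /\
  forall G, min_homog_gens J G -> \max_(g <- G) ext_degree g = d.

(* Main.v *)
Require Import Defs.
From mathcomp Require Import all_boot all_order all_algebra.
From mathcomp Require Import ssrcomplements mpoly zify.
From Stdlib Require Classical_Prop.

(** The presentation map sends a monomial of [S] to a monomial of [R[t]], so the
    presentation ideal is spanned by the differences of two monomials with the
    same image ([presentation_ideal_min]). It is enough to rewrite any monomial
    [x^u y^al w^c] into any other one [x^v y^be w^d] with the same image, by
    means of the proposed binomials ([cong_img]). Say [d <= c].

    If [c = d], then [al] and [be] have the same degree, and Koszul forms move
    the exponents of [y] one unit at a time ([multinom_exchange],
    [cong_same_w]). If [delta = c - d] is positive, then the degree of [be]
    exceeds that of [al] by [delta], and
    [u_i + b delta = v_i + a (be_i - al_i)] for all [i]. Let [B] be the largest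
    difference [be_i - al_i], and [T] a set of as many as possible, but at most
    [delta], of the indices where it is reached. Then [u_i >= a - |T| b] on [T],
    unless [a <= n b] and [delta > r] ([step_set]). So the binomial attached to
    [T] applies and lowers the exponent of [w] by [|T|]. In the exceptional case
    the binomial of degree [r + 1] applies, since its term [w^(r+1)] has no
    coefficient; one set of size [r + 1] is enough for this.

    The reduction number is computed from the powers of [I]
    ([reduction_number_value]). When [a <= n b], it is governed by the monomial
    [(x_1...x_n)^((s+1) b)], which is divisible by every product of [s + 1]
    distinct [x_i^a] if [a <= (s + 1) b], and by no [x_i^a] otherwise. When
    [a > n b], the lower bound comes from the linear form which adds up the
    coefficients of the monomials of degree [s + 1] in the [x_i^a]: it kills the
    ideal [Q] if [s + 1 < n].

    The binomial attached to [i |: T] is a Sylvester form of the one attached to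
    [T] and of [L_i], with respect to a power of [x_i] and a power of the
    product of the [x_j], [j] in [T] ([sylvester_step]); all the binomials are
    reached by adding indices one at a time.

    As to the relation type, generators of degree greater than [r + 1] are
    superfluous in any homogeneous generating set ([generates_low_degree]).
    Degree [r + 1] is needed, because the monomial [w^(r+1)], or [y_1...y_n]
    when [a > n b], has coefficient [1] or [-1] in some relation, whereas its
    proper divisors share their image with no other monomial
    ([relation_type_presentation]). *)

Import GRing.Theory.
Set Implicit Arguments.
Unset Strict Implicit.
Unset Printing Implicit Defensive.

(** * Ideals *)

Section Ideals.
Local Open Scope ring_scope.
Variable A : comNzRingType.
Implicit Types (P G : A -> Prop) (f g c : A).

(** Ideals are predicates on the ring, closed under sums and multiples. *)
Definition is_ideal P :=
  [/\ P 0, forall f g, P f -> P g -> P (f + g) & forall c f, P f -> P (c * f)].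

Lemma is_idealN P f : is_ideal P -> P f -> P (- f).
Proof. by case=> _ _ PM Pf; rewrite -mulN1r; apply: PM. Qed.

Lemma is_idealB P f g : is_ideal P -> P f -> P g -> P (f - g).
Proof.
by move=> idP Pf Pg; have [_ PD _] := idP; apply: PD => //; apply: is_idealN.
Qed.

Lemma is_ideal_sum P (T : eqType) (s : seq T) (F : T -> A) :
  is_ideal P -> (forall t, t \in s -> P (F t)) -> P (\sum_(t <- s) F t).
Proof.
move=> [P0 PD _] PF; rewrite big_seq; apply: big_ind => //.
Qed.

Lemma ideal_gen_ideal G : is_ideal (ideal_gen G).
Proof.
split.
- by exists [::]; split=> //; rewrite big_nil.
- move=> f g [s [Gs ->]] [t [Gt ->]]; exists (s ++ t); rewrite big_cat.
  by split=> // c; rewrite mem_cat => /orP[/Gs|/Gt].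
move=> c f [s [Gs ->]]; exists [seq (c * t.1, t.2) | t <- s]; split.
  by move=> _ /mapP[t /Gs Gt ->].
by rewrite big_map mulr_sumr; apply: eq_bigr => t _; rewrite mulrA.
Qed.

Lemma mem_ideal_gen G g : G g -> ideal_gen G g.
Proof.
move=> Gg; exists [:: (1, g)]; rewrite big_seq1 mul1r; split=> // c.
by rewrite inE => /eqP ->.
Qed.

Lemma ideal_gen_min G P :
  is_ideal P -> (forall g, G g -> P g) -> forall f, ideal_gen G f -> P f.
Proof.
move=> idP GP f [s [Gs ->]]; apply: is_ideal_sum => // t /Gs /GP Pt.
by have [_ _ PM] := idP; apply: PM.
Qed.

Lemma ideal_mul_ideal P1 P2 : is_ideal (ideal_mul P1 P2).
Proof. exact: ideal_gen_ideal. Qed.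

Lemma mem_ideal_mul P1 P2 f g : P1 f -> P2 g -> ideal_mul P1 P2 (f * g).
Proof. by move=> P1f P2g; apply: mem_ideal_gen; exists f, g. Qed.

(** A product of ideals is generated by the products of generators. *)
Lemma ideal_mul_gen_min G1 G2 P :
  is_ideal P -> (forall f g, G1 f -> G2 g -> P (f * g)) ->
  forall h, ideal_mul (ideal_gen G1) (ideal_gen G2) h -> P h.
Proof.
move=> idP GP; apply: ideal_gen_min => // _ [f [g [G1f G2g ->]]].
have [P0 PD PM] := idP.
move: f G1f; apply: (@ideal_gen_min G1 (fun f => P (f * g))).
  split=> [|f1 f2 Pf1 Pf2|c f Pf]; first by rewrite mul0r.
    by rewrite mulrDl; apply: PD.
  by rewrite -mulrA; apply: PM.
move=> f G1f; move: g G2g; apply: ideal_gen_min => [|g G2g]; last exact: GP.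
split=> [|g1 g2 Pg1 Pg2|c g Pg]; first by rewrite mulr0.
  by rewrite mulrDr; apply: PD.
by rewrite mulrCA; apply: PM.
Qed.

Lemma ideal_mulS P1 P2 Q :
  (forall f, P1 f -> P2 f) -> forall f, ideal_mul P1 Q f -> ideal_mul P2 Q f.
Proof.
move=> sP; apply: ideal_gen_min; first exact: ideal_mul_ideal.
by move=> _ [f [g [P1f Qg ->]]]; apply: mem_ideal_mul => //; apply: sP.
Qed.

Lemma mmap1D N (h : 'I_N -> A) (m1 m2 : 'X_{1..N}) :
  mmap1 h (m1 + m2)%MM = mmap1 h m1 * mmap1 h m2.
Proof. by rewrite commr_mmap1_M // => *; apply: mulrC. Qed.

(** The [m]-th power of an ideal is generated by the degree [m] monomials in
    its generators. *)
Lemma mem_ideal_exp_prod N (h : 'I_N -> A) (al : 'X_{1..N}) :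
  ideal_exp (ideal_gen (fun g => exists j, g = h j)) (mdeg al) (mmap1 h al).
Proof.
move em : (mdeg al) => m; elim: m al em => [|m IH] al em //.
have /existsP[j alj] : [exists j, al j != 0%N].
  apply/existsP; apply/existsP; apply: contraPT em => /existsPn al0.
  rewrite (_ : al = 0%MM) ?mdeg0 //; apply/mnmP=> j.
  by have := al0 j; rewrite negbK mnm0E => /eqP.
have le1 : (U_(j) <= al)%MM by rewrite lep1mP.
rewrite -(submK le1) addmC mmap1D mmap1U.
apply: mem_ideal_mul; first by apply: mem_ideal_gen; exists j.
apply: IH; have := congr1 (@mdeg N) (submK le1).
by rewrite mdegD mdeg1 em addn1 => -[].
Qed.

Lemma ideal_exp_gen_min N (h : 'I_N -> A) m P :
  is_ideal P ->
  (forall al : 'X_{1..N}, mdeg al = m -> P (mmap1 h al)) ->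
  forall f, ideal_exp (ideal_gen (fun g => exists j, g = h j)) m f -> P f.
Proof.
move=> idP Pal.
suff Hm f : ideal_exp (ideal_gen (fun g => exists j, g = h j)) m f ->
  ideal_gen (fun g => exists2 al : 'X_{1..N}, mdeg al = m & g = mmap1 h al) f.
  move=> f /Hm; apply: ideal_gen_min => // _ [al em ->]; exact: Pal.
elim: m f {P idP Pal} => [|m IH] f.
  move=> _; rewrite -[f]mulr1; have [_ _ GM] := ideal_gen_ideal
    (fun g => exists2 al : 'X_{1..N}, mdeg al = 0%N & g = mmap1 h al).
  apply: GM; apply: mem_ideal_gen; exists 0%MM; first exact: mdeg0.
  by rewrite mmap11.
move=> /= Hf; have {Hf} : ideal_mul (ideal_gen (fun g => exists j, g = h j))
  (ideal_gen (fun g => exists2 al : 'X_{1..N}, mdeg al = m & g = mmap1 h al)) f.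
  move: f Hf; apply: ideal_gen_min; first exact: ideal_mul_ideal.
  by move=> _ [f [g [If /IH Ig ->]]]; apply: mem_ideal_mul.
move: f; apply: ideal_mul_gen_min; first exact: ideal_gen_ideal.
move=> _ _ [j ->] [al em ->]; apply: mem_ideal_gen.
exists (U_(j) + al)%MM; first by rewrite mdegD mdeg1 em.
by rewrite mmap1D mmap1U.
Qed.

End Ideals.

(** * Monomials of S and their images in the Rees algebra *)

Section Monomials.
Local Open Scope ring_scope.
Variables (k : fieldType) (n : nat).
Implicit Types (u v m al be : 'X_{1..n}) (c d : nat).
Implicit Types (i : 'I_n) (T : {set 'I_n}).

(** The exponent of [y ^ al * w ^ c]; [w] is the last variable of [S]. *)
Definition ext al c : 'X_{1..n.+1} :=
  [multinom if unlift ord_max j is Some i then al i else c | j < n.+1].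

(** The monomial [x ^ u * y ^ al * w ^ c] of [S]. *)
Definition mon u al c : polyS k n := 'X_[u] *: 'X_[ext al c].

Lemma ext_lift al c i : ext al c (lift ord_max i) = al i.
Proof. by rewrite mnmE liftK. Qed.

Lemma ext_max al c : ext al c ord_max = c.
Proof. by rewrite mnmE unlift_none. Qed.

Lemma extP (m1 m2 : 'X_{1..n.+1}) :
  (forall i, m1 (lift ord_max i) = m2 (lift ord_max i)) ->
  m1 ord_max = m2 ord_max -> m1 = m2.
Proof.
by move=> e1 e2; apply/mnmP=> j; case: (unliftP ord_max j) => [i|] ->.
Qed.

Lemma extD al c be d : (ext al c + ext be d)%MM = ext (al + be)%MM (c + d).
Proof. by apply: extP => [i|]; rewrite mnmDE ?ext_lift ?ext_max ?mnmDE. Qed.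

Lemma ext_eq al c be d : (ext al c == ext be d) = (al == be) && (c == d).
Proof.
apply/eqP/andP=> [e|[/eqP-> /eqP->] //]; split; apply/eqP.
  by apply/mnmP=> i; rewrite -(ext_lift al c) e ext_lift.
by rewrite -(ext_max al c) e ext_max.
Qed.

Lemma ext_surj (m' : 'X_{1..n.+1}) :
  m' = ext [multinom m' (lift ord_max i) | i < n] (m' ord_max).
Proof. by apply: extP => [i|]; rewrite ?ext_lift ?ext_max ?mnmE. Qed.

Lemma big_ord_last (V : Type) (idx : V) (op : Monoid.com_law idx)
    (F : 'I_n.+1 -> V) :
  \big[op/idx]_(j < n.+1) F j =
  op (\big[op/idx]_(i < n) F (lift ord_max i)) (F ord_max).
Proof.
rewrite big_ord_recr /=; congr (op _ _); apply: eq_bigr => i _.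
by congr (F _); apply: val_inj; rewrite /= /bump leqNgt ltn_ord.
Qed.

Lemma mdeg_ext al c : mdeg (ext al c) = (mdeg al + c)%N.
Proof.
rewrite mdegE big_ord_last /= ext_max mdegE; congr (_ + _)%N.
by apply: eq_bigr => i _; rewrite ext_lift.
Qed.

Lemma monM u al c v be d :
  mon u al c * mon v be d = mon (u + v)%MM (al + be)%MM (c + d).
Proof. by rewrite /mon -scalerAl -scalerAr scalerA -!mpolyXD extD. Qed.

Lemma mcoeff_mon u al c (m' : 'X_{1..n.+1}) m :
  (mon u al c)@_m'@_m = ((u == m) && (ext al c == m'))%:R.
Proof.
by rewrite /mon mcoeffZ mcoeffX; case: (_ == m');
  rewrite ?mulr1 ?mulr0 ?mcoeff0 ?mcoeffX ?andbT ?andbF.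
Qed.

Lemma mcoeff_binomial u al c v be d m al' c' :
  (mon u al c - mon v be d)@_(ext al' c')@_m =
  [&& u == m, al == al' & c == c']%:R - [&& v == m, be == al' & d == c']%:R.
Proof. by rewrite !mcoeffB !mcoeff_mon !ext_eq. Qed.

Lemma mon_dhomog u al c : mon u al c \is (mdeg al + c).-homog.
Proof. by apply: rpredZ; rewrite dhomogX; apply/eqP; exact: mdeg_ext. Qed.

Lemma mesym1E_sum T : mesym1 T = (\sum_(i in T) U_(i))%MM.
Proof.
apply/mnmP=> i; rewrite mnmE mnm_sumE big_mkcond /=.
rewrite (bigD1 i) //= mnmE eqxx /= big1 ?addn0 => [|j ne_ji].
  by case: ifP.
by case: (_ \in _); rewrite // mnmE (negbTE ne_ji).
Qed.

Lemma xprodE T : xprod k T = 'X_[mesym1 T].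
Proof. by rewrite /xprod /xvar mesym1E_sum mprodXE. Qed.

Lemma yvarE i : yvar k i = 'X_[ext U_(i)%MM 0].
Proof.
rewrite /yvar; congr 'X_[_]; apply: extP => [j|]; rewrite ?ext_lift ?ext_max.
  by rewrite !mnm1E (inj_eq lift_inj).
by rewrite mnm1E eq_sym (negbTE (neq_lift _ _)).
Qed.

Lemma wvarE : wvar k n = 'X_[ext 0%MM 1].
Proof.
rewrite /wvar; congr 'X_[_]; apply: extP => [j|]; rewrite ?ext_lift ?ext_max.
  by rewrite mnm1E mnm0E (negbTE (neq_lift _ _)).
by rewrite mnm1E eqxx.
Qed.

Lemma ext0 : ext 0 0 = 0%MM.
Proof. by apply: extP => [i|]; rewrite ?ext_lift ?ext_max !mnm0E. Qed.

Lemma ext_mulm al c d : (ext al c *+ d)%MM = ext (al *+ d)%MM (c * d).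
Proof. by apply: extP => [i|]; rewrite mulmnE ?ext_lift ?ext_max ?mulmnE. Qed.

Lemma yprodE T : yprod k T = 'X_[ext (mesym1 T) 0].
Proof.
rewrite /yprod (eq_bigr _ (fun i _ => yvarE i)).
rewrite mprodXE; congr 'X_[_].
apply: extP => [i|]; rewrite mnm_sumE ?ext_lift ?ext_max.
  by rewrite mesym1E_sum mnm_sumE; apply: eq_bigr => j _; rewrite ext_lift.
by rewrite big1 // => j _; rewrite ext_max.
Qed.

Lemma wvarXE d : wvar k n ^+ d = 'X_[ext 0%MM d].
Proof.
have e0 : (0 *+ d)%MM = 0%MM :> 'X_{1..n}.
  by apply/mnmP=> i; rewrite mulmnE mnm0E mul0n.
by rewrite wvarE mpolyXn ext_mulm mul1n e0.
Qed.

Lemma xvarXE i d : xvar k i ^+ d = 'X_[(U_(i) *+ d)%MM].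
Proof. by rewrite /xvar mpolyXn. Qed.

Section Rees.
Variables a b : nat.

(** The presentation map sends [mon u al c] to a monomial of [R] times a power
    of [t]; this is the exponent of the monomial of [R]. *)
Definition img u al c := (u + al *+ a + mesym1 [set: 'I_n] *+ (b * c))%MM.

Lemma imgE u al c i : img u al c i = (u i + al i * a + b * c)%N.
Proof. by rewrite !mnmDE !mulmnE mnmE inE mul1n. Qed.

Lemma I_gens_lift i : I_gens k a b (lift ord_max i) = 'X_[(U_(i) *+ a)%MM].
Proof. by rewrite /I_gens liftK xvarXE. Qed.

Lemma I_gens_max :
  I_gens k a b (ord_max : 'I_n.+1) = 'X_[(mesym1 [set: 'I_n] *+ b)%MM].
Proof. by rewrite /I_gens unlift_none xprodE mpolyXn. Qed.

Lemma mmap1_I_gens al c : mmap1 (I_gens k a b) (ext al c) = 'X_[img 0 al c].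
Proof.
rewrite /mmap1 big_ord_last /= ext_max I_gens_max mpolyXn.
rewrite (eq_bigr (fun i => 'X_[((U_(i) *+ a) *+ al i)%MM])); last first.
  by move=> i _; rewrite I_gens_lift ext_lift mpolyXn.
rewrite mprodXE -mpolyXD; congr 'X_[_]; apply/mnmP=> i.
rewrite imgE !mnmDE mnm_sumE mulmnE mulmnE mnmE inE mnm0E mul1n.
congr (_ + _)%N.
rewrite (bigD1 i) //= big1 ?addn0; last first.
  by move=> j /negbTE nij; rewrite !mulmnE mnm1E nij.
by rewrite !mulmnE mnm1E eqxx mul1n add0n mulnC.
Qed.

Lemma rees_map_ideal : is_ideal (presentation_ideal k n a b).
Proof.
rewrite /presentation_ideal /rees_map; split=> [|f g f0 g0|c f f0].
- by rewrite raddf0.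
- by rewrite raddfD /= f0 g0 addr0.
by rewrite rmorphM /= f0 mulr0.
Qed.

Lemma rees_mapD : {morph @rees_map k n a b : f g / f + g}.
Proof. by move=> f g; rewrite /rees_map raddfD. Qed.

Lemma rees_mapB : {morph @rees_map k n a b : f g / f - g}.
Proof. by move=> f g; rewrite /rees_map raddfB. Qed.

Lemma rees_mapZ (c : polyR k n) (f : polyS k n) :
  rees_map a b (c *: f) = c%:P * rees_map a b f :> {poly polyR k n}.
Proof. by rewrite /rees_map mmapZ. Qed.

Lemma rees_map_mon u al c :
  rees_map a b (mon u al c) = 'X_[img u al c] *: 'X^(mdeg al + c).
Proof.
rewrite rees_mapZ /rees_map mmapX.
have -> : mmap1 (fun j => I_gens k a b j *: 'X) (ext al c) =
   (mmap1 (I_gens k a b) (ext al c)) *: 'X^(mdeg al + c).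
  rewrite /mmap1; under eq_bigr do rewrite exprZn.
  rewrite scaler_prod.
  by rewrite -mdeg_ext mdegE -expr_sum.
rewrite mmap1_I_gens mul_polyC scalerA -mpolyXD; congr ('X_[_] *: _).
by apply/mnmP=> i; rewrite mnmDE !imgE mnm0E; lia.
Qed.

End Rees.
End Monomials.

(** * Combinatorics of exponents *)

Section Multinomials.
Variable n : nat.
Implicit Types (al be m : 'X_{1..n}) (i j : 'I_n) (T U : {set 'I_n}).

Lemma mesym1_in T i : mesym1 T i = (i \in T) :> nat.
Proof. by rewrite mnmE. Qed.

Lemma subset_of_card T d :
  d <= #|T| -> exists2 U : {set 'I_n}, U \subset T & #|U| = d.
Proof.
move=> le_m; exists [set x in take d (enum T)].
  by apply/subsetP=> x; rewrite inE => /mem_take; rewrite mem_enum.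
rewrite cardsE; have /card_uniqP -> : uniq (take d (enum T)).
  by rewrite take_uniq ?enum_uniq.
by rewrite size_take -cardE; case: ltngtP le_m.
Qed.

Lemma multinom_gt_exists al be :
  mdeg al = mdeg be -> al != be -> exists i, be i < al i.
Proof.
move=> edeg nab; apply/existsP; apply: contraNT nab => /existsPn le_ab.
have le : (al <= be)%MM by apply/mnm_lepP=> i; rewrite leqNgt.
have := congr1 (@mdeg n) (submK le); rewrite mdegD edeg => /eqP.
rewrite -[X in _ == X]add0n eqn_add2r mdeg_eq0 => /eqP e0.
by rewrite -(submK le) e0 add0m.
Qed.

(** Two exponents of the same degree are joined by unit moves, each from a
    coordinate that is too large to one that is too small. *)
Lemma multinom_exchange (P : 'X_{1..n} -> Prop) be :
  P be ->
  (forall al i j, mdeg al = mdeg be -> be i < al i -> al j < be j ->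
     P (al - U_(i) + U_(j))%MM -> P al) ->
  forall al, mdeg al = mdeg be -> P al.
Proof.
move=> Pbe step al; have [N] := ubnP (mdeg (al - be)%MM).
elim: N al => // N IH al; rewrite ltnS => leN edeg.
have [->//|nab] := eqVneq al be.
have [i lti] := multinom_gt_exists edeg nab.
have [|j ltj] := multinom_gt_exists (esym edeg); first by rewrite eq_sym.
have le1 : (U_(i) <= al)%MM by rewrite lep1mP; lia.
have nij : j != i by apply: contraTneq lti => <-; lia.
apply: (step _ i j) => //; apply: IH; last first.
  by rewrite -edeg -{2}(submK le1) !mdegD !mdeg1.
apply: leq_trans leN.
have le2 : (U_(i) <= al - be)%MM by rewrite lep1mP mnmBE; lia.
rewrite -(submK le2) mdegD mdeg1 addn1.
suff -> : (al - U_(i) + U_(j) - be = al - be - U_(i))%MM by [].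
apply/mnmP=> l; rewrite !(mnmBE, mnmDE, mnm1E).
by case: (eqVneq j l) => [<-|_]; rewrite ?(eq_sym i) ?(negbTE nij); lia.
Qed.

End Multinomials.

(** * Ideals and linear forms defined by coefficients *)

Section CoefficientIdeals.
Local Open Scope ring_scope.

Lemma ideal_mul_subl (A : comNzRingType) (P1 P2 : A -> Prop) f :
  is_ideal P1 -> ideal_mul P1 P2 f -> P1 f.
Proof.
move=> idP; move: f; apply: ideal_gen_min => // _ [f [g [Pf _ ->]]].
by have [_ _ PM] := idP; rewrite mulrC; apply: PM.
Qed.

(** Since divisors of divisors are divisors, the polynomials whose
    coefficients at the divisors of a monomial lie in an ideal form an ideal. *)
Lemma divisor_coef_ideal (A : comNzRingType) N (P : A -> Prop)
    (M : 'X_{1..N}) :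
  is_ideal P ->
  is_ideal (fun f : {mpoly A[N]} => forall m, (m <= M)%MM -> P f@_m).
Proof.
move=> [P0 PD PM]; split=> [m _|f g Pf Pg m le_m|c f Pf m le_m].
- by rewrite mcoeff0.
- by rewrite mcoeffD; apply: PD; [apply: Pf | apply: Pg].
rewrite mcoeffM; apply: big_ind => // -[m1 m2] /eqP /= em.
by apply: PM; apply: Pf; apply: (lepm_trans _ le_m); apply/mnm_lepP=> i;
  have /mnmP/(_ i) := em; rewrite mnmDE => ->; rewrite leq_addl.
Qed.

Lemma eq0_ideal (A : comNzRingType) : is_ideal (fun c : A => c = 0).
Proof. by split=> [//|f g -> ->|c f ->]; rewrite ?addr0 ?mulr0. Qed.

End CoefficientIdeals.

Section LinearExtension.
Local Open Scope ring_scope.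
Variables (k : fieldType) (n : nat) (phi : 'X_{1..n} -> k).
Implicit Types (f g : {mpoly k[n]}).

(** The linear form on polynomials with prescribed values on monomials. *)
Definition mlin f : k := \sum_(m <- msupp f) f@_m * phi m.

Lemma mlinE f d : (msize f <= d)%N ->
  mlin f = \sum_(m : 'X_{1..n < d}) f@_m * phi m.
Proof.
move=> le_d; pose bm : subFinType _ := 'X_{1..n < d}.
rewrite /mlin (big_mksub bm) ?msupp_uniq //=.
  by rewrite big_rmcond //= => j /memN_msupp_eq0 ->; rewrite mul0r.
by move=> x /msize_mdeg_lt /leq_trans; apply.
Qed.

Lemma mlinD f g : mlin (f + g) = mlin f + mlin g.
Proof.
pose d := maxn (maxn (msize f) (msize g)) (msize (f + g)).
rewrite !(@mlinE _ d) ?leq_max ?leqnn ?orbT // -big_split /=.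
by apply: eq_bigr => m _; rewrite mcoeffD mulrDl.
Qed.

Lemma mlinZ c f : mlin (c *: f) = c * mlin f.
Proof.
pose d := maxn (msize f) (msize (c *: f)).
rewrite !(@mlinE _ d) ?leq_max ?leqnn ?orbT // mulr_sumr.
by apply: eq_bigr => m _; rewrite mcoeffZ mulrA.
Qed.

Lemma mlin0 : mlin 0 = 0.
Proof. by rewrite /mlin msupp0 big_nil. Qed.

Lemma mlinX m : mlin 'X_[m] = phi m.
Proof. by rewrite /mlin msuppX big_seq1 mcoeffX eqxx mul1r. Qed.

Lemma mlin_ideal : is_ideal (fun f => forall c, mlin (c * f) = 0).
Proof.
split=> [c|f g Pf Pg c|c f Pf d]; first by rewrite mulr0 mlin0.
  by rewrite mulrDr mlinD Pf Pg addr0.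
by rewrite mulrA Pf.
Qed.

Lemma mlin_mul0 f :
  (forall m, mlin ('X_[m] * f) = 0) -> forall c, mlin (c * f) = 0.
Proof.
move=> Xf0; elim/mpolyind => [|c m p _ _ IH]; first by rewrite mul0r mlin0.
by rewrite mulrDl mlinD IH addr0 -scalerAl mlinZ Xf0 mulr0.
Qed.

End LinearExtension.

(** * The reduction number *)

Section ReductionNumber.
Local Open Scope ring_scope.
Variables (k : fieldType) (n a b : nat).
Hypotheses (hn : (0 < n)%N) (hb : (0 < b)%N) (hab : (2 * b < a)%N).
Implicit Types (al be m : 'X_{1..n}) (i j : 'I_n).

Local Notation I := (idealI k n a b).
Local Notation X u := ('X_[u%MM] : {mpoly k[n]}).

Lemma idealJ_sub f : idealJ k n a f -> I f.
Proof.
move: f; apply: ideal_gen_min; first exact: ideal_gen_ideal.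
move=> _ [i ->]; apply: mem_ideal_gen; exists (lift ord_max i).
by rewrite I_gens_lift xvarXE.
Qed.

Lemma idealI_w : I (xprod k [set: 'I_n] ^+ b).
Proof.
by apply: mem_ideal_gen; exists ord_max; rewrite I_gens_max xprodE mpolyXn.
Qed.

Lemma idealQ_sub f : idealQ k n a b f -> I f.
Proof.
move: f; apply: ideal_gen_min; first exact: ideal_gen_ideal.
move=> _ [[i [l [_ _ ->]]]|->]; last exact: idealI_w.
by apply: is_idealB; first exact: ideal_gen_ideal;
  apply: idealJ_sub; apply: mem_ideal_gen; eexists.
Qed.

Lemma mem_idealI_exp al c : ideal_exp I (mdeg al + c) (X (img a b 0 al c)).
Proof. by rewrite -mmap1_I_gens -mdeg_ext; apply: mem_ideal_exp_prod. Qed.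

Lemma idealI_exp_min s (P : {mpoly k[n]} -> Prop) :
  is_ideal P ->
  (forall al c, (mdeg al + c = s)%N -> P (X (img a b 0 al c))) ->
  forall f, ideal_exp I s f -> P f.
Proof.
move=> idP Pal; apply: ideal_exp_gen_min => // m em.
by rewrite (ext_surj m) mmap1_I_gens; apply: Pal; rewrite -mdeg_ext -ext_surj.
Qed.

Lemma img_split al c i : al i != 0%N ->
  X (img a b 0 al c) = X (U_(i) *+ a) * X (img a b 0 (al - U_(i)) c).
Proof.
move=> ali; rewrite -mpolyXD; congr 'X_[_]; apply/mnmP=> j.
rewrite mnmDE !imgE mulmnE mnmBE mnm1E mnm0E.
by case: eqVneq => [<-|_]; nia.
Qed.

Lemma mdegB1 al i : al i != 0%N -> (mdeg al = (mdeg (al - U_(i))%MM).+1)%N.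
Proof.
move=> ali; have le1 : (U_(i) <= al)%MM by rewrite lep1mP.
by rewrite -{1}(submK le1) mdegD mdeg1 addn1.
Qed.

(** If [a <= (s + 1) b], then the power [s + 1] of the product of the
    [x_i ^ b] is divisible by the product of any [s + 1] distinct [x_i ^ a]. *)
Lemma idealJ_reduction s : (s < n)%N -> (a <= s.+1 * b)%N ->
  ideal_eq (ideal_exp I s.+1) (ideal_mul (idealJ k n a) (ideal_exp I s)).
Proof.
move=> lt_sn le_a f; split; last exact: (ideal_mulS idealJ_sub).
have idM : is_ideal (ideal_mul (idealJ k n a) (ideal_exp I s)).
  exact: ideal_mul_ideal.
have [_ _ MM] := idM.
have main al c i : al i != 0%N -> (mdeg al + c = s.+1)%N ->
    ideal_mul (idealJ k n a) (ideal_exp I s) (X (img a b 0 al c)).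
  move=> ali; rewrite (mdegB1 ali) addSn => -[<-].
  rewrite (img_split _ ali); apply: mem_ideal_mul; last exact: mem_idealI_exp.
  by apply: mem_ideal_gen; exists i; rewrite xvarXE.
move: f; apply: idealI_exp_min => // al c es.
have [/existsP[i ali]|/existsPn al0] := boolP [exists i, al i != 0%N].
  exact: main ali es.
have [T _ cT] : exists2 T : {set 'I_n}, T \subset [set: 'I_n] & #|T| = s.+1.
  by apply: subset_of_card; rewrite cardsT card_ord.
have /set0Pn[i iT] : T != set0 by rewrite -card_gt0 cT.
have {}al0 j : al j = 0%N.
  by have := al0 j; rewrite negbK => /eqP.
have ec : c = s.+1 by rewrite -es mdegE big1 // => j _; rewrite al0.
have -> : X (img a b 0 al c) =
    X (img a b 0 al c - mesym1 T *+ a) * X (img a b 0 (mesym1 T) 0).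
  rewrite -mpolyXD; congr 'X_[_]; apply/mnmP=> j.
  rewrite mnmDE mnmBE mulmnE !imgE mnm0E al0 mesym1_in ec.
  by case: (j \in T); lia.
apply: MM; apply: (main _ _ i); first by rewrite mesym1_in iT.
by rewrite mdeg_mesym1 addn0.
Qed.

(** No [x_i ^ a] divides the power [s + 1] of the product of the [x_i ^ b]. *)
Lemma idealJ_not_reduction s : (s.+1 * b < a)%N ->
  ~ ideal_eq (ideal_exp I s.+1) (ideal_mul (idealJ k n a) (ideal_exp I s)).
Proof.
move=> lt_a /(_ (X (img a b 0 0 s.+1)))[IJ _].
have := mem_idealI_exp 0 s.+1; rewrite mdeg0 => /IJ.
move=> /(ideal_mul_subl (ideal_gen_ideal _)).
pose M := img a b 0 (0 : 'X_{1..n})%MM s.+1.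
move=> HM; have := ideal_gen_min (divisor_coef_ideal M (eq0_ideal _)) _ HM.
move=> /(_ _ M (lepm_refl _))/eqP.
rewrite mcoeffX eqxx oner_eq0 => /(_ _)/notF.
apply=> _ [i ->] m /mnm_lepP /(_ i).
rewrite xvarXE mcoeffX; case: eqP => // <-.
by rewrite imgE mulmnE mnm1E !mnm0E eqxx; lia.
Qed.

(** Modulo the differences of the [x_i ^ a], every product of [n] of them is
    the product of all of them, which is a multiple of the product of the
    [x_i ^ (n b)] as soon as [n b < a]. *)
Lemma idealQ_reduction s : n = s.+1 -> (n * b < a)%N ->
  ideal_eq (ideal_exp I s.+1) (ideal_mul (idealQ k n a b) (ideal_exp I s)).
Proof.
move=> en lt_a f; split; last exact: (ideal_mulS idealQ_sub).
have idM : is_ideal (ideal_mul (idealQ k n a b) (ideal_exp I s)).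
  exact: ideal_mul_ideal.
have [_ MD MM] := idM.
have Qid : is_ideal (idealQ k n a b) by apply: ideal_gen_ideal.
have lt_sn : (s < n)%N by rewrite en.
pose l := Ordinal lt_sn.
have Ql i : idealQ k n a b (X (U_(i) *+ a) - X (U_(l) *+ a)).
  have [->|nil] := eqVneq i l; first by rewrite subrr; case: Qid.
  apply: mem_ideal_gen; left; exists i, l; rewrite !xvarXE; split=> //.
  by have := ltn_ord i; rewrite -(inj_eq val_inj) /= in nil *; lia.
have Qij i j : idealQ k n a b (X (U_(i) *+ a) - X (U_(j) *+ a)).
  by have := is_idealB Qid (Ql i) (Ql j); rewrite opprB addrA subrK.
have Qw : idealQ k n a b (X (mesym1 [set: 'I_n] *+ b)).
  by apply: mem_ideal_gen; right; rewrite xprodE mpolyXn.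
move: f; apply: idealI_exp_min => // al [|c].
  pose P al := ideal_mul (idealQ k n a b) (ideal_exp I s) (X (img a b 0 al 0)).
  rewrite addn0 => es; move: es.
  have -> : s.+1 = mdeg (mesym1 [set: 'I_n]).
    by rewrite mdeg_mesym1 cardsT card_ord.
  move: al; apply: (multinom_exchange (P := P)) => [|al i j ed lti ltj Pal].
    rewrite /P.
    have -> : X (img a b 0 (mesym1 [set: 'I_n]) 0) =
        X (mesym1 [set: 'I_n] *+ (a - n * b)) *
        (X (mesym1 [set: 'I_n] *+ b) * X (img a b 0 0 s)).
      rewrite -!mpolyXD; congr 'X_[_]; apply/mnmP=> j.
      rewrite !(imgE, mnmDE) !mulmnE mesym1_in inE !mnm0E; nia.
    apply: MM; apply: mem_ideal_mul => //.
    by have := mem_idealI_exp 0 s; rewrite mdeg0.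
  have ali : al i != 0%N by lia.
  rewrite /P -[X _](subrK (X (img a b 0 (al - U_(i) + U_(j)) 0))).
  apply: MD => //.
  have -> : X (img a b 0 al 0) - X (img a b 0 (al - U_(i) + U_(j)) 0) =
      (X (U_(i) *+ a) - X (U_(j) *+ a)) * X (img a b 0 (al - U_(i)) 0).
    rewrite mulrBl -img_split // -mpolyXD; congr (_ - 'X_[_]); apply/mnmP=> l'.
    by rewrite !(imgE, mnmDE) !mulmnE; lia.
  apply: mem_ideal_mul => //.
  have -> : s = (mdeg (al - U_(i))%MM + 0)%N.
    by have := mdegB1 ali; rewrite ed mdeg_mesym1 cardsT card_ord; lia.
  exact: mem_idealI_exp.
rewrite addnS => -[<-].
have -> : X (img a b 0 al c.+1) =
    X (mesym1 [set: 'I_n] *+ b) * X (img a b 0 al c).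
  rewrite -mpolyXD; congr 'X_[_]; apply/mnmP=> j.
  by rewrite mnmDE !imgE mulmnE mesym1_in inE; lia.
by apply: mem_ideal_mul => //; apply: mem_idealI_exp.
Qed.

(** The linear form adding up the coefficients of the monomials of degree
    [s + 1] in the [x_i ^ a] vanishes on [Q] for [s + 1 < n], but not on
    [x_l ^ (a (s + 1))]. *)
Lemma idealQ_not_reduction s : (s.+1 < n)%N ->
  ~ ideal_eq (ideal_exp I s.+1) (ideal_mul (idealQ k n a b) (ideal_exp I s)).
Proof.
move=> lt_sn; pose l := Ordinal hn.
move=> /(_ (X (img a b 0 (U_(l) *+ s.+1) 0)))[IQ _].
have := mem_idealI_exp (U_(l) *+ s.+1)%MM 0.
rewrite mdegMn mdeg1 mul1n addn0 => /IQ.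
move=> /(ideal_mul_subl (ideal_gen_ideal _)).
pose phi m : k :=
  ([forall i : 'I_n, (a %| m i)%N] && (mdeg m == a * s.+1)%N)%:R.
move=> /(ideal_gen_min (mlin_ideal phi)) Hphi.
have /(_ 1) : forall c, mlin phi (c * (X (img a b 0 (U_(l) *+ s.+1) 0))) = 0.
  apply: Hphi => g [[i [j [_ _ ->]]]|->]; apply: mlin_mul0 => m.
    rewrite !xvarXE mulrBr -!mpolyXD -scaleN1r mlinD mlinZ !mlinX mulN1r.
    apply/eqP; rewrite subr_eq0 /phi !mdegD !mdegMn !mdeg1; apply/eqP.
    congr ((_ && _)%:R); apply: eq_forallb => l'.
    by rewrite !mnmDE !mulmnE !dvdn_addl ?dvdn_mull.
  (* A multiple of the product of the [x_i ^ b] in which all the exponents are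
     divisible by [a] has degree at least [n a]. *)
  rewrite xprodE mpolyXn -mpolyXD mlinX /phi.
  case: andP => // -[/forallP dv /eqP ed].
  have : (n * a <= a * s.+1)%N.
    rewrite -ed mdegE -{1}(card_ord n) -sum_nat_const; apply: leq_sum => i _.
    apply: dvdn_leq (dv i); rewrite mnmDE mulmnE mesym1_in inE; lia.
  by nia.
rewrite mul1r mlinX /phi; case: andP => [_ /eqP|[]]; first by rewrite oner_eq0.
split.
  apply/forallP=> i; rewrite imgE mnm0E muln0 addn0 add0n.
  exact: dvdn_mull.
by rewrite /img !mdegD !mdegMn mdeg0 mdeg1 muln0; apply/eqP; lia.
Qed.

(** The reduction number [r] enters the rest of the argument only through these
    two implications. *)
Lemma reduction_number_value r :
  reduction_number (min_reduction k n a b) I r ->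
  ((a <= n * b)%N -> (r * b < a <= r.+1 * b)%N) /\
  ((n * b < a)%N -> r.+1 = n).
Proof.
rewrite /reduction_number /min_reduction.
have [le_a|lt_a] := leqP a (n * b) => -[eq_r ne_s].
  split=> [_|//].
  apply/andP; split; last first.
    by rewrite leqNgt; apply/negP=> /idealJ_not_reduction.
  rewrite ltnNge; apply/negP=> le_ar.
  have [lt_rn|le_nr] := leqP r n.
    case: r lt_rn le_ar ne_s {eq_r} => [|r] lt_rn le_ar ne_s; first by lia.
    by apply: (ne_s r) => //; apply: idealJ_reduction.
  apply: (ne_s n.-1); first by lia.
  by apply: idealJ_reduction; rewrite ?(prednK hn).
split=> [//|_].
have en := prednK hn.
have [lt_rn|lt_nr|//] := ltngtP r.+1 n.
  by case: (idealQ_not_reduction lt_rn).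
by case: (ne_s n.-1); [lia | apply: idealQ_reduction; rewrite ?prednK].
Qed.

End ReductionNumber.

(** * The binomials and the step that lowers the exponent of w *)

Section Forms.
Local Open Scope ring_scope.
Variables (k : fieldType) (n a b r : nat).
Implicit Types (i j : 'I_n) (T : {set 'I_n}).

Lemma koszulE i j :
  koszul k a i j =
  mon k (U_(i) *+ a)%MM U_(j)%MM 0 - mon k (U_(j) *+ a)%MM U_(i)%MM 0.
Proof. by rewrite /koszul !xvarXE !yvarE. Qed.

Lemma koszulN i j : koszul k a i j = - koszul k a j i.
Proof. by rewrite /koszul opprB. Qed.

(** The exponents of [x] in the two terms of the binomial attached to [T].
    By truncated subtraction the same formulas cover the last binomial when
    [a <= n b], where [w] occurs without a coefficient. *)
Definition Fsrc T := (mesym1 T *+ (a - #|T| * b))%MM.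
Definition Fdst T :=
  (mesym1 (~: T) *+ (#|T| * b) + mesym1 T *+ (#|T| * b - a))%MM.

Lemma FsrcE T i : Fsrc T i = ((i \in T) * (a - #|T| * b))%N.
Proof. by rewrite mulmnE mesym1_in. Qed.

Lemma FdstE T i :
  Fdst T i = ((i \notin T) * (#|T| * b) + (i \in T) * (#|T| * b - a))%N.
Proof. by rewrite mnmDE !mulmnE !mesym1_in inE. Qed.

Lemma img_F T i :
  img a b (Fsrc T) 0%MM #|T| i = img a b (Fdst T) (mesym1 T) 0 i.
Proof.
by rewrite !imgE FsrcE FdstE mnm0E mesym1_in; case: (i \in T) => /=; lia.
Qed.

Lemma binomial_in_kernel u al c v be d :
  img a b u al c = img a b v be d -> (mdeg al + c = mdeg be + d)%N ->
  presentation_ideal k n a b (mon k u al c - mon k v be d).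
Proof.
move=> e1 e2.
by rewrite /presentation_ideal rees_mapB !rees_map_mon e1 e2 subrr.
Qed.

Lemma koszul_in_kernel i j : presentation_ideal k n a b (koszul k a i j).
Proof.
rewrite koszulE; apply: binomial_in_kernel; rewrite ?mdeg1 //.
by apply/mnmP=> l; rewrite !imgE !mulmnE; lia.
Qed.

Hypotheses (hb : (0 < b)%N) (hab : (2 * b < a)%N).
Hypothesis hJ : (a <= n * b)%N -> (r * b < a <= r.+1 * b)%N.
Hypothesis hQ : (n * b < a)%N -> r.+1 = n.

Lemma red_ltn : (r < n)%N.
Proof.
have [le_a|lt_a] := leqP a (n * b); first by have := hJ le_a; nia.
by have := hQ lt_a; lia.
Qed.

Lemma red_bound : (r * b < a)%N.
Proof.
have [/hJ/andP[]//|lt_a] := leqP a (n * b).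
by have := red_ltn; nia.
Qed.

Lemma FformE T : (0 < #|T| <= r.+1)%N ->
  Fform k a b r T = mon k (Fsrc T) 0%MM #|T| - mon k (Fdst T) (mesym1 T) 0.
Proof.
move=> /andP[_ le_T]; have hr := red_bound.
rewrite /Fform /mon !wvarXE yprodE /Pprod -!/(xprod _ _) !xprodE !mpolyXn.
case: ifP => [/andP[/hJ/andP[_ le_a] /eqP eT]|not_top].
  rewrite -mpolyXD; have -> : Fsrc T = 0%MM; last by rewrite mpolyX0 scale1r.
  by apply/mnmP=> i; rewrite FsrcE mnm0E eT; lia.
rewrite /Fdst (_ : #|T| * b - a = 0)%N ?mulm0n ?addm0 //.
have [le_a|lt_a] := leqP a (n * b).
  have ltT : (#|T| < r.+1)%N.
    by rewrite ltn_neqAle le_T andbT; case: eqP not_top; rewrite ?le_a.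
  by nia.
by move: (hQ lt_a) => er; nia.
Qed.

Lemma LformE i : Lform k a b i =
  mon k (Fsrc [set i]) 0%MM 1 - mon k (Fdst [set i]) (mesym1 [set i]) 0.
Proof.
rewrite /Lform /Pprod -!/(xprod _ _) xprodE xvarXE mpolyXn yvarE.
rewrite wvarE /mon /Fsrc /Fdst cards1 mul1n mesym1_set1.
by rewrite (_ : b - a = 0)%N ?mulm0n ?addm0 //; lia.
Qed.

Lemma Fform_in_kernel T : (0 < #|T| <= r.+1)%N ->
  presentation_ideal k n a b (Fform k a b r T).
Proof.
move=> hT; rewrite FformE //; apply: binomial_in_kernel.
  by apply/mnmP=> i; apply: img_F.
by rewrite mdeg0 mdeg_mesym1 addn0.
Qed.

(** Let [u, al] and [v, be] be the exponents of [x] and [y] in two monomials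
    with the same image, the first having [delta] more factors [w] than the
    second. If moreover [delta <= r] in case [a <= n b], then the first one is
    divisible by the term in [w] of the binomial attached to some [T]; such a
    [T] is found among the indices at which the exponent of [y] has to grow
    most. *)
Lemma step_set u al v be delta :
  (0 < delta)%N -> mdeg be = (mdeg al + delta)%N ->
  (forall i, u i + al i * a + b * delta = v i + be i * a)%N ->
  ((a <= n * b)%N -> (delta <= r)%N) ->
  exists T, [/\ (0 < #|T|)%N, (#|T| <= delta)%N &
    forall i, i \in T -> (a <= u i + #|T| * b)%N].
Proof.
move=> delta0 edeg eimg le_delta.
pose B := \max_(i < n) (be i - al i)%N.
pose TB := [set i | be i == (al i + B)%N].
have leB i : (be i - al i <= B)%N.
  exact: (@leq_bigmax _ (fun i => be i - al i)%N i).
have B0 : (0 < B)%N.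
  rewrite lt0n; apply/negP=> /eqP eB0.
  have : (mdeg be <= mdeg al)%N.
    by rewrite !mdegE; apply: leq_sum => i _; have := leB i; lia.
  by lia.
have TB0 : (0 < #|TB|)%N.
  have n0 : (0 < #|'I_n|)%N.
    by rewrite card_ord; apply: leq_ltn_trans red_ltn.
  have [i eB] := eq_bigmax (fun i => be i - al i)%N n0.
  rewrite card_gt0; apply/set0Pn; exists i; rewrite inE.
  by move: eB; rewrite -/B; lia.
have le_sum : (delta <= n * B.-1 + #|TB|)%N.
  have : (mdeg be <= \sum_(i < n) (al i + (B.-1 + (i \in TB))))%N.
    rewrite mdegE; apply: leq_sum => i _; rewrite inE.
    by have := leB i; case: eqP; lia.
  rewrite !big_split /= sum_nat_const card_ord -mdegE edeg.
  have -> : (\sum_(i < n) (i \in TB) = #|TB|)%N.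
    by rewrite -sum1_card [RHS]big_mkcond; apply: eq_bigr => i _; case: ifP.
  by rewrite leq_add2l.
have [T sT cT] := @subset_of_card _ TB (minn #|TB| delta) (geq_minl _ _).
exists T; rewrite cT; split; [by lia | by lia |].
move=> i /(subsetP sT); rewrite inE => /eqP ei.
have eui := eimg i; rewrite {}ei mulnDl in eui.
have [le_a|lt_a] := leqP a (n * b).
  have lt_delta : (b * delta < a)%N.
    by apply: leq_ltn_trans red_bound; rewrite mulnC leq_mul2r le_delta ?orbT.
  have [eB1|B2] : B = 1%N \/ (1 < B)%N by lia.
    have -> : minn #|TB| delta = delta by move: le_sum; rewrite eB1; lia.
    by move: eui; rewrite eB1; lia.
  have : (2 * a <= B * a)%N by rewrite leq_mul2r B2 orbT.
  by lia.
(* The sum of the increments of the exponents of [y] is at most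
   [n (B - 1) + #|TB|], and [n b < a]. *)
have [->|le_TB] : minn #|TB| delta = delta \/ (#|TB| < delta)%N by lia.
  by nia.
have : (b * delta <= a * B.-1 + #|TB| * b)%N by nia.
by rewrite (minn_idPl (ltnW le_TB)); nia.
Qed.

Section Congruence.
Variable L : polyS k n -> Prop.
Hypothesis idL : is_ideal L.

Lemma cong_trans f g h : L (f - g) -> L (g - h) -> L (f - h).
Proof.
by move=> fg gh; have [_ LD _] := idL; rewrite -[f](subrK g) -addrA; apply: LD.
Qed.

(** Replacing one term of a binomial of [L] by the other in a monomial. *)
Lemma cong_step s p d s' p' d' :
  L (mon k s p d - mon k s' p' d') ->
  forall u al c, (s <= u)%MM -> (p <= al)%MM -> (d <= c)%N ->
  L (mon k u al c - mon k (u - s + s')%MM (al - p + p')%MM (c - d + d')).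
Proof.
move=> Lf u al c su pal dc; have [_ _ LM] := idL.
have -> : mon k u al c = mon k (u - s)%MM (al - p)%MM (c - d) * mon k s p d.
  by rewrite monM (submK su) (submK pal) (subnK dc).
by rewrite -!monM -mulrBr; apply: LM.
Qed.

Hypothesis LK : forall i j, (i < j)%N -> L (koszul k a i j).
Hypothesis LF : forall T, (0 < #|T| <= r)%N -> L (Fform k a b r T).
Variable T0 : {set 'I_n}.
Hypothesis cT0 : #|T0| = r.+1.
Hypothesis LF0 : L (Fform k a b r T0).

Lemma koszul_mem i j : L (koszul k a i j).
Proof.
have [lt_ij|lt_ji|/val_inj ->] := ltngtP i j; first exact: LK.
  by rewrite koszulN; apply: is_idealN => //; apply: LK.
by rewrite /koszul subrr; case: idL.
Qed.

(** With equal exponents of [w] the Koszul forms suffice. *)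
Lemma cong_same_w u al v be c :
  mdeg al = mdeg be -> img a b u al c = img a b v be c ->
  L (mon k u al c - mon k v be c).
Proof.
move=> edeg; move: al edeg u.
apply: multinom_exchange => [u /mnmP e|al i j _ lti ltj IH u /mnmP e].
  have -> : u = v by apply/mnmP=> i; have := e i; rewrite !imgE; lia.
  by rewrite subrr; case: idL.
have uj : (a <= u j)%N by have := e j; rewrite !imgE; nia.
have := koszul_mem j i; rewrite koszulE => /cong_step /(_ u al c).
rewrite subn0 addn0 => Hstep; apply: cong_trans (Hstep _ _ (leq0n _)) _.
- apply/mnm_lepP=> l; rewrite mulmnE mnm1E.
  by case: eqVneq => [<-|]; lia.
- by rewrite lep1mP; lia.
apply: IH; apply/mnmP=> l; rewrite -e !imgE !mnmDE !mnmBE !mulmnE !mnm1E.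
have nij : i != j by apply: contraTneq lti => ->; lia.
case: (eqVneq j l) => [<-|_]; first by rewrite (negbTE nij); nia.
by case: (eqVneq i l) => [<-|_]; nia.
Qed.

Lemma Fform_cong T : (0 < #|T| <= r.+1)%N ->
  ((a <= n * b)%N -> (#|T| <= r)%N) \/ T = T0 ->
  L (mon k (Fsrc T) 0%MM #|T| - mon k (Fdst T) (mesym1 T) 0).
Proof.
move=> hT HT; have /andP[T_gt0 leT] := hT; rewrite -(FformE hT).
case: HT => [HT|->//]; have [leTr|ltT] := leqP #|T| r.
  by apply: LF; rewrite T_gt0.
have [le_a|lt_a] := leqP a (n * b); first by have := HT le_a; lia.
have full (U : {set 'I_n}) : #|U| = r.+1 -> U = [set: 'I_n].
  move=> cU; apply/eqP; rewrite eqEcard subsetT cardsT card_ord cU.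
  by rewrite (hQ lt_a) leqnn.
by rewrite (full T) -?(full T0) //; lia.
Qed.

(** Two monomials with the same image are congruent modulo [L]. *)
Lemma cong_img u al c v be d : (d <= c)%N ->
  (mdeg al + c = mdeg be + d)%N -> img a b u al c = img a b v be d ->
  L (mon k u al c - mon k v be d).
Proof.
have [N] := ubnP c; elim: N c u al => // N IH c u al ltN le_dc edeg eimg.
have [e_cd|ne_cd] := eqVneq c d.
  by subst c; apply: cong_same_w => //; lia.
have lt_dc : (d < c)%N by lia.
have eimg' i : (u i + al i * a + b * (c - d) = v i + be i * a)%N.
  by have /mnmP/(_ i) := eimg; rewrite !imgE; nia.
have reduce T : (0 < #|T| <= r.+1)%N -> (#|T| <= c - d)%N ->
    ((a <= n * b)%N -> (#|T| <= r)%N) \/ T = T0 ->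
    (forall i, i \in T -> (a <= u i + #|T| * b)%N) ->
    L (mon k u al c - mon k v be d).
  move=> hT leT HT Tu; have := Fform_cong hT HT.
  move=> /cong_step /(_ u al c) Hstep; apply: cong_trans (Hstep _ _ _) _.
  - apply/mnm_lepP=> i; rewrite FsrcE.
    by case: (boolP (i \in T)) => [/Tu|_]; lia.
  - by apply/mnm_lepP=> i; rewrite mnm0E.
  - by lia.
  apply: IH.
  - by lia.
  - by lia.
  - by rewrite subm0 mdegD mdeg_mesym1; lia.
  rewrite -eimg; apply/mnmP=> i; have := img_F T i.
  rewrite !imgE !mnmDE !mnmBE !mnm0E.
  have : (Fsrc T i <= u i)%N.
    by rewrite FsrcE; case: (boolP (i \in T)) => [/Tu|_]; lia.
  by nia.
have [/andP[le_a lt_r]|not_top] := boolP ((a <= n * b) && (r < c - d))%N.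
  (* Here [w ^ (r + 1)] occurs in the binomial without a coefficient. *)
  apply: (reduce T0); rewrite ?cT0 ?leqnn //; first by right.
  by move=> i _; have /andP[] := hJ le_a; lia.
have [|||T [T_gt0 leT Tu]] := step_set _ _ eimg'; [by lia | by lia | |].
  by move=> le_a; move: not_top; rewrite le_a /=; lia.
have le_Tr : (#|T| <= r.+1)%N.
  have [le_a|lt_a] := leqP a (n * b).
    move: not_top; rewrite le_a /= -leqNgt => le_r.
    exact: leq_trans leT (leqW le_r).
  by rewrite (hQ lt_a) -[X in (_ <= X)%N]card_ord max_card.
apply: (reduce T) => //; first by rewrite T_gt0.
left=> le_a; move: not_top; rewrite le_a /= -leqNgt.
exact: leq_trans.
Qed.

End Congruence.
End Forms.

(** * Binomials span the presentation ideal *)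

Section Kernel.
Local Open Scope ring_scope.
Variables (k : fieldType) (n a b : nat).
Local Notation expo := ('X_{1..n} * 'X_{1..n.+1})%type.
Implicit Types (x : expo) (s : seq (k * expo)).

(** Monomials of [S], indexed by the pair of their exponents in the [x_i] and in
    the variables over [R]. *)
Definition emon x : polyS k n := 'X_[x.1] *: 'X_[x.2].

(** The exponents in [R] and in [t] of the image of a monomial of [S]. *)
Definition ekey x : 'X_{1..n} * nat :=
  (img a b x.1 [multinom x.2 (lift ord_max i) | i < n] (x.2 ord_max), mdeg x.2).

Lemma emonE x :
  emon x = mon k x.1 [multinom x.2 (lift ord_max i) | i < n] (x.2 ord_max).
Proof. by rewrite /mon -ext_surj. Qed.

Lemma rees_map_emon x :
  rees_map a b (emon x) = 'X_[(ekey x).1] *: 'X^((ekey x).2).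
Proof. by rewrite emonE rees_map_mon -mdeg_ext -ext_surj. Qed.

Lemma polyS_emon (f : polyS k n) :
  exists s, f = \sum_(t <- s) t.1%:MP *: emon t.2.
Proof.
exists [seq ((f@_m')@_m, (m, m')) | m' <- msupp f, m <- msupp f@_m'].
rewrite big_allpairs_dep {1}[f]mpolyE; apply: eq_bigr => m' _.
rewrite {1}[f@_m']mpolyE scaler_suml; apply: eq_bigr => m _ /=.
by rewrite /emon scalerA mul_mpolyC.
Qed.

Lemma rees_map_sum s :
  rees_map a b (\sum_(t <- s) t.1%:MP *: emon t.2) =
  \sum_(t <- s) (t.1 *: 'X_[(ekey t.2).1]) *: 'X^((ekey t.2).2).
Proof.
elim: s => [|t s IH]; first by rewrite !big_nil /rees_map raddf0.
rewrite !big_cons rees_mapD IH rees_mapZ rees_map_emon.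
by rewrite mul_polyC scalerA mul_mpolyC.
Qed.

Lemma coef_rees_map_sum s (q : 'X_{1..n} * nat) :
  (rees_map a b (\sum_(t <- s) t.1%:MP *: emon t.2))`_(q.2)@_(q.1) =
  \sum_(t <- s | ekey t.2 == q) t.1.
Proof.
rewrite rees_map_sum coef_sum raddf_sum /= [RHS]big_mkcond /=.
apply: eq_bigr => t _; rewrite coefZ coefXn -pair_eqE /pair_eq [q.2 == _]eq_sym.
case: eqP => [_|_]; last by rewrite andbF mulr0 mcoeff0.
by rewrite mulr1 andbT mcoeffZ mcoeffX; case: eqP => _; rewrite ?mulr1 ?mulr0.
Qed.

(** The presentation ideal is spanned by the differences of two monomials with
    the same image. *)
Lemma presentation_ideal_min (L : polyS k n -> Prop) :
  is_ideal L ->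
  (forall u al c v be d, (mdeg al + c = mdeg be + d)%N ->
     img a b u al c = img a b v be d -> L (mon k u al c - mon k v be d)) ->
  forall f, presentation_ideal k n a b f -> L f.
Proof.
move=> idL Lbin f; have [s ->] := polyS_emon f; rewrite /presentation_ideal.
have [L0 LD LM] := idL.
have Lkey x y : ekey x = ekey y -> L (emon x - emon y).
  move=> exy; rewrite !emonE; apply: Lbin; last exact: (congr1 fst exy).
  by rewrite -!mdeg_ext -!ext_surj; apply: (congr1 snd exy).
have [N] := ubnP (size s); elim: N s => // N IH [|t s].
  by move=> _ _; rewrite big_nil.
rewrite ltnS /= => lt_sN; pose P (t' : k * expo) := ekey t'.2 == ekey t.2.
pose F (t' : k * expo) := t'.1%:MP *: emon t'.2 : polyS k n.
(* The terms with the same image as the first one are split off; the sum of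
   their coefficients is a coefficient of the image of the whole sum. *)
have Fsplit : \sum_(t' <- t :: s) F t' =
    \sum_(t' <- t :: s | P t') F t' + \sum_(t' <- [seq t' <- s | ~~ P t']) F t'.
  rewrite (bigID P) /= [X in _ + X]big_cons /P eqxx /=.
  by rewrite big_filter.
move=> F0; have C0 : \sum_(t' <- t :: s | P t') t'.1 = 0.
  by rewrite -(coef_rees_map_sum _ (ekey t.2)) F0 coef0 mcoeff0.
have same : \sum_(t' <- t :: s | P t') F t' =
    \sum_(t' <- t :: s | P t') t'.1%:MP *: (emon t'.2 - emon t.2).
  have e0 : \sum_(t' <- t :: s | P t') t'.1%:MP *: emon t.2 = 0.
    transitivity ((\sum_(t' <- t :: s | P t') t'.1)%:MP *: emon t.2).
      by rewrite raddf_sum scaler_suml.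
    by rewrite C0 raddf0 scale0r.
  rewrite -[LHS]subr0 -[X in _ - X]e0 -sumrB.
  by apply: eq_bigr => t' _; rewrite scalerBr.
have Lsame : L (\sum_(t' <- t :: s | P t') F t').
  rewrite same; apply: big_ind => // t' /eqP /Lkey Lt'.
  by rewrite -mul_mpolyC; apply: LM.
rewrite Fsplit; apply: LD => //; apply: IH.
  by rewrite size_filter; apply: leq_ltn_trans lt_sN; rewrite count_size.
have ker_same : rees_map a b (\sum_(t' <- t :: s | P t') F t') = 0.
  rewrite -big_filter rees_map_sum big_filter.
  rewrite (eq_bigr (fun t' =>
    (t'.1 *: 'X_[(ekey t.2).1]) *: 'X^((ekey t.2).2))).
    by rewrite -scaler_suml -scaler_suml C0 !scale0r.
  by move=> t' /eqP ->.
by move: F0; rewrite -/(F _) Fsplit rees_mapD ker_same add0r.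
Qed.

End Kernel.

(** * Sylvester forms *)

Section RegularPairs.
Local Open Scope ring_scope.
Variables (k : fieldType) (n : nat).
Implicit Types (m : 'X_{1..n}) (f g h : {mpoly k[n]}).

Lemma mpolyX_neq0 m : 'X_[m] != 0 :> {mpoly k[n]}.
Proof. by rewrite -msize_poly_eq0 msizeX. Qed.

Lemma mcoeff_XM_neq0 m f m' : ('X_[m] * f)@_m' != 0 -> (m <= m')%MM.
Proof.
rewrite -mcoeff_msupp => /msuppM_le /allpairsP[[m1 m2] /= [+ _ ->]].
by move=> /mem_msuppXP ->; apply: lem_addr.
Qed.

Lemma mpolyX_dvd m f :
  (forall m', f@_m' != 0 -> (m <= m')%MM) -> exists g, f = 'X_[m] * g.
Proof.
move=> le_m; exists (\sum_(m' <- msupp f) f@_m' *: 'X_[m' - m]).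
rewrite {1}[f]mpolyE mulr_sumr big_seq [RHS]big_seq; apply: eq_bigr => m'.
by rewrite mcoeff_msupp => /le_m le; rewrite -scalerAr -mpolyXD addmC submK.
Qed.

(** Two nontrivial monomials without a common variable form a regular
    sequence. *)
Lemma regular_pair_mpolyX m1 m2 :
  m1 != 0%MM -> m2 != 0%MM -> (forall i, m1 i = 0%N \/ m2 i = 0%N) ->
  regular_pair ('X_[m1] : {mpoly k[n]}) 'X_[m2].
Proof.
move=> nz1 nz2 disj; split.
- by move=> h /eqP; rewrite mulf_eq0 (negbTE (mpolyX_neq0 _)) => /eqP.
- move=> h c e; apply: mpolyX_dvd => m; rewrite -(mcoeffMX _ m2).
  rewrite mulrC addmC e => /mcoeff_XM_neq0 /mnm_lepP le; apply/mnm_lepP=> i.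
  by have := le i; rewrite mnmDE; case: (disj i) => ->; lia.
case=> c [d /(congr1 (mcoeff 0%MM))].
rewrite mcoeffD !rmorphM /= !mcoeffX (negbTE nz1) (negbTE nz2) !mulr0 addr0.
by rewrite mcoeff1 eqxx => /esym/eqP; rewrite oner_eq0.
Qed.

End RegularPairs.

Section Sylvester.
Local Open Scope ring_scope.
Variables (k : fieldType) (n a b r : nat).
Hypotheses (hb : (0 < b)%N) (hab : (2 * b < a)%N).
Hypothesis hJ : (a <= n * b)%N -> (r * b < a <= r.+1 * b)%N.
Hypothesis hQ : (n * b < a)%N -> r.+1 = n.
Implicit Types (i j : 'I_n) (T : {set 'I_n}).

Lemma sylvester_form_mx (f g A B C D : polyS k n) (u v : polyR k n) :
  regular_pair u v ->
  f = A * u%:MP + B * v%:MP -> g = C * u%:MP + D * v%:MP ->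
  sylvester_form f g u v (A * D - B * C).
Proof.
move=> reg -> ->; split=> //.
exists (\matrix_(p < 2, q < 2) if p == ord0 then (if q == ord0 then A else B)
                               else (if q == ord0 then C else D)).
split; last first.
  rewrite (expand_det_row _ ord0) big_ord_recl big_ord1 /cofactor !det_mx11.
  by rewrite !mxE /= expr0 mul1r expr1 mulN1r mulrN.
apply/matrixP=> p q; rewrite !mxE big_ord_recl big_ord1 !mxE /=.
by case: (p == ord0).
Qed.

Lemma binomial_congr (u1 u2 v1 v2 al1 al2 be1 be2 : 'X_{1..n}) c1 c2 d1 d2 :
  u1 =1 u2 -> al1 =1 al2 -> c1 = c2 -> v1 =1 v2 -> be1 =1 be2 -> d1 = d2 ->
  mon k u1 al1 c1 - mon k v1 be1 d1 = mon k u2 al2 c2 - mon k v2 be2 d2.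
Proof. by move=> /mnmP -> /mnmP -> -> /mnmP -> /mnmP -> ->. Qed.

Lemma mpolyCX (m : 'X_{1..n}) : 'X_[m]%:MP = mon k m 0%MM 0.
Proof. by rewrite /mon ext0 mpolyX0 -mul_mpolyC mulr1. Qed.

(** The binomial attached to [i |: T] is a Sylvester form of the one attached
    to [T] and of [L_i], with respect to a power of [x_i] and a power of the
    product of the [x_j] for [j] in [T]; the exponents are the largest for
    which both binomials lie in the ideal generated by the two powers. *)
Lemma sylvester_step T i : (0 < #|T| <= r)%N -> i \notin T ->
  exists u v, sylvester_form (Fform k a b r T) (Lform k a b i) u v
    (Fform k a b r (i |: T)).
Proof.
move=> /andP[T_gt0 leT] niT; set d := #|T|.
have da : (d * b < a)%N.
  by apply: leq_ltn_trans (red_bound hb hab hJ hQ); rewrite leq_mul2r leT orbT.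
have cT' : #|i |: T| = d.+1 by rewrite cardsU1 niT.
pose e1 := minn (a - b) (d * b); pose e2 := minn (a - d * b) b.
have e1_gt0 : (0 < e1)%N by rewrite /e1; nia.
have e2_gt0 : (0 < e2)%N by rewrite /e2; lia.
pose mu := (U_(i) *+ e1)%MM; pose mv := (mesym1 T *+ e2)%MM.
have muE j : mu j = ((i == j) * e1)%N by rewrite mulmnE mnm1E.
have mvE j : mv j = ((j \in T) * e2)%N by rewrite mulmnE mesym1_in.
exists 'X_[mv], 'X_[mu].
pose A := mon k (Fsrc a b T - mv)%MM 0%MM d.
pose B := - mon k (Fdst a b T - mu)%MM (mesym1 T) 0.
pose C := - mon k (Fdst a b [set i] - mv)%MM (mesym1 [set i]) 0.
pose D := mon k (Fsrc a b [set i] - mu)%MM 0%MM 1.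
have -> : Fform k a b r (i |: T) = A * D - B * C.
  rewrite (FformE k hb hab hJ hQ) cT' // /A /B /C /D mulrNN !monM addn1.
  apply: binomial_congr => [j|j|//|j|j|//].
  - rewrite mnmDE !mnmBE !FsrcE muE mvE cT' cards1 -/d !inE [i == j]eq_sym.
    rewrite /e1 /e2; case: (eqVneq j i) => [->|_].
      by rewrite (negbTE niT) /=; nia.
    by case: (j \in T) => /=; nia.
  - by rewrite mnmDE !mnm0E.
  - rewrite mnmDE !mnmBE !FdstE muE mvE cT' cards1 -/d !inE [i == j]eq_sym.
    rewrite /e1 /e2; case: (eqVneq j i) => [->|_].
      by rewrite (negbTE niT) /=; nia.
    by case: (j \in T) => /=; nia.
  rewrite mnmDE !mesym1_in !inE.
  by case: (eqVneq j i) => [->|_]; rewrite ?(negbTE niT) ?addn0.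
apply: sylvester_form_mx.
- apply: regular_pair_mpolyX.
  + have /set0Pn[j jT] : T != set0 by rewrite -card_gt0.
    by apply/eqP=> /mnmP /(_ j); rewrite mvE mnm0E jT; lia.
  + by apply/eqP=> /mnmP /(_ i); rewrite muE mnm0E eqxx; lia.
  move=> j; rewrite mvE muE.
  by case: eqVneq => [<-|]; rewrite ?(negbTE niT); [left|right].
- rewrite (FformE k hb hab hJ hQ) -/d; last by rewrite T_gt0; lia.
  rewrite /A /B !mpolyCX mulNr !monM !addm0 !addn0 !submK //.
    apply/mnm_lepP=> j; rewrite muE FdstE /e1 -/d.
    by case: eqVneq => [<-|_]; rewrite ?niT ?(negbTE niT) /=; lia.
  by apply/mnm_lepP=> j; rewrite mvE FsrcE /e2 -/d; case: (j \in T); lia.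
rewrite (LformE k hb hab hJ hQ) /C /D !mpolyCX mulNr !monM !addm0 !addn0 !submK.
- by rewrite addrC.
- apply/mnm_lepP=> j; rewrite muE FsrcE cards1 inE eq_sym /e1.
  by case: eqVneq; lia.
apply/mnm_lepP=> j; rewrite mvE FdstE cards1 !inE /e2.
case: (boolP (j \in T)) => [jT|//].
have -> : j != i by apply: contraNneq niT => <-.
by lia.
Qed.

Lemma Fform_iterated_sylvester T : (0 < #|T| <= r.+1)%N ->
  iterated_sylvester a b (Fform k a b r T).
Proof.
have [d cT] : exists d, #|T| = d by exists #|T|.
elim: d T cT => [|[|d] IH] T cT; rewrite cT // => le_d.
  have /eqP/cards1P[i eT] := cT; subst T.
  have -> : Fform k a b r [set i] = Lform k a b i.
    rewrite (FformE k hb hab hJ hQ); last by rewrite cards1.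
    by rewrite cards1 (LformE k hb hab hJ hQ).
  exact: IterL.
have /set0Pn[i iT] : T != set0 by rewrite -card_gt0 cT.
have cT' : #|T :\ i| = d.+1 by have := cardsD1 i T; rewrite iT cT => -[].
have [||u [v]] := @sylvester_step (T :\ i) i; first by rewrite cT'; lia.
  by rewrite !inE eqxx.
rewrite setD1K //; apply: IterSylvester; last exact: IterL.
by apply: IH => //; rewrite cT'; lia.
Qed.

End Sylvester.

(** * Minimal homogeneous generators and the relation type *)

Section MinimalGenerators.
Local Open Scope ring_scope.
Variables (k : fieldType) (n : nat) (J : polyS k n -> Prop).
Implicit Types (G : seq (polyS k n)) (f g c : polyS k n).

Local Notation mdegm := (Measure.clone n.+1 mdeg _).

Lemma ideal_gen_subset (A : comNzRingType) (G1 G2 : seq A) (f : A) :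
  {subset G1 <= G2} ->
  ideal_gen (fun g : A => g \in G1) f -> ideal_gen (fun g : A => g \in G2) f.
Proof.
move=> sG; move: f; apply: ideal_gen_min; first exact: ideal_gen_ideal.
by move=> g /sG gG; apply: mem_ideal_gen.
Qed.

Lemma min_homog_gens_exists G :
  (forall g, g \in G -> exists d, g \is d.-homog) -> generates J G ->
  exists G', min_homog_gens J G'.
Proof.
have [N] := ubnP (size G); elim: N G => // N IH G.
rewrite ltnS => leN homG genG.
case: (Classical_Prop.classic (exists G', [/\ {subset G' <= G}, generates J G' &
  ~ {subset G <= G'}])) => [[G' [sG' genG' nsG]]|minG]; last first.
  exists G; split=> // G' sG' genG'; apply: Classical_Prop.NNPP => nsG.
  by apply: minG; exists G'.
pose G'' := [seq g <- G | g \in G'].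
have eG'' : G'' =i G'.
  by move=> g; rewrite mem_filter; case: (boolP (g \in G')) => //= /sG' ->.
apply: (IH G'').
- apply: leq_trans leN; rewrite size_filter ltn_neqAle count_size andbT.
  by rewrite -all_count; apply/negP=> /allP.
- by move=> g; rewrite eG'' => /sG' /homG.
move=> f; rewrite genG'; split; apply: ideal_gen_subset => g; by rewrite eG''.
Qed.

Lemma pihomog_mul_homog d e c g : g \is e.-homog ->
  ((d < e)%N -> pihomog mdegm d (c * g) = 0) /\
  exists c', pihomog mdegm d (c * g) = c' * g.
Proof.
move=> hg.
have piE j : pihomog mdegm d (pihomog mdegm j c * g) =
    if (j + e == d)%N then pihomog mdegm j c * g else 0.
  have hom : pihomog mdegm j c * g \is (j + e).-homog.
    by apply: dhomogM => //; apply: pihomogP.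
  case: eqP => [<-|/eqP ne]; first by rewrite pihomog_dE.
  by rewrite (pihomog_ne0 ne).
have eqc : pihomog mdegm d (c * g) = \sum_(j < msize c)
    if (j + e == d)%N then pihomog mdegm j c * g else 0.
  rewrite {1}[c](pihomog_partitionE (mf := mdegm) (leqnn _)).
  by rewrite mulr_suml raddf_sum; apply: eq_bigr => j _; exact: piE.
split.
  move=> lt_de; rewrite eqc big1 // => j _; case: eqP => //; lia.
exists (\sum_(j < msize c | (j + e == d)%N) pihomog mdegm j c).
by rewrite eqc mulr_suml [RHS]big_mkcond.
Qed.

(** An ideal generated in degrees at most [D] is generated by those members
    of any homogeneous generating set whose degree is at most [D]. *)
Lemma generates_low_degree (D : nat) G0 G :
  (forall g, g \in G0 -> exists2 d, (d <= D)%N & g \is d.-homog) ->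
  generates J G0 ->
  (forall g, g \in G -> exists d, g \is d.-homog) -> generates J G ->
  generates J [seq g <- G | (ext_degree g <= D)%N].
Proof.
move=> homG0 genG0 homG genG f; split.
  move=> /genG0; move: f; apply: ideal_gen_min.
    exact: ideal_gen_ideal.
  move=> g0 g0G0; have [d le_dD hom_g0] := homG0 _ g0G0.
  have [s [sG eg0]] : ideal_gen (fun g => g \in G) g0.
    by apply/genG/genG0; apply: mem_ideal_gen.
  rewrite -(pihomog_dE hom_g0) eg0 raddf_sum /=.
  apply: is_ideal_sum; first exact: ideal_gen_ideal.
  move=> [c g] /sG /= gG; have [e hom_g] := homG _ gG.
  have [gen0 _ genM] := ideal_gen_ideal
    (fun g => g \in [seq g <- G | (ext_degree g <= D)%N]).
  have [->|nzg] := eqVneq g 0; first by rewrite mulr0 raddf0.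
  have ee : ext_degree g = e.
    by apply: (dhomog_uniq nzg _ hom_g); apply: dhomog_msize hom_g.
  have [pi0 [c' pi_c']] := pihomog_mul_homog d c hom_g.
  have [le_eD|lt_De] := leqP e D.
    rewrite pi_c'; apply: genM; apply: mem_ideal_gen.
    by rewrite mem_filter ee le_eD.
  by rewrite pi0 //; apply: leq_ltn_trans lt_De.
by move=> /(ideal_gen_subset (mem_subseq (filter_subseq _ _)))/genG.
Qed.

Lemma min_homog_gens_degree (D : nat) G0 G :
  (forall g, g \in G0 -> exists2 d, (d <= D)%N & g \is d.-homog) ->
  generates J G0 -> min_homog_gens J G ->
  forall g, g \in G -> (ext_degree g <= D)%N.
Proof.
move=> homG0 genG0 [homG genG minG] g gG.
have gen' := generates_low_degree homG0 genG0 homG genG.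
have /(_ g gG) := minG _ (mem_subseq (filter_subseq _ _)) gen'.
by rewrite mem_filter => /andP[].
Qed.

End MinimalGenerators.

Section LowDegree.
Local Open Scope ring_scope.
Variables (k : fieldType) (n a b r : nat).
Hypotheses (hn : (0 < n)%N) (hb : (0 < b)%N) (hab : (2 * b < a)%N).
Hypothesis hJ : (a <= n * b)%N -> (r * b < a <= r.+1 * b)%N.
Hypothesis hQ : (n * b < a)%N -> r.+1 = n.
Implicit Types (m : 'X_{1..n.+1}) (f g : polyS k n) (T : {set 'I_n}).

(** A monomial of [S] without factors [x] which shares its image with no other
    monomial has coefficient [0] in every relation. *)
Lemma coef0_presentation_ideal m f :
  (forall u al c, (mdeg al + c = mdeg m)%N ->
     img a b u al c = (ekey a b (0%MM, m)).1 -> u = 0%MM /\ ext al c = m) ->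
  presentation_ideal k n a b f -> f@_m@_0%MM = 0.
Proof.
move=> uniq_m; have [s ->] := polyS_emon f => f0.
have := coef_rees_map_sum a b s (ekey a b (0%MM, m)).
rewrite (f0 : rees_map _ _ _ = 0) coef0 mcoeff0 => ->.
rewrite !raddf_sum /= [RHS]big_mkcond /=; apply: eq_bigr => -[c [u m1]] _ /=.
rewrite emonE mcoeffZ mcoeffCM mcoeff_mon -ext_surj /=.
suff -> : (ekey a b (u, m1) == ekey a b (0%MM, m)) = (u == 0%MM) && (m1 == m).
  by case: ifP => _; rewrite ?mulr1 ?mulr0.
apply/eqP/andP => [e|[/eqP -> /eqP ->] //].
have [] := uniq_m u [multinom m1 (lift ord_max i) | i < n] (m1 ord_max).
- by rewrite -mdeg_ext -ext_surj; apply: (congr1 snd e).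
- exact: (congr1 fst e).
by rewrite -ext_surj => -> ->.
Qed.

(** The exponent of a monomial of degree [r + 1] in the variables over [R],
    namely [w ^ (r + 1)] or the product of the [y_i]. It occurs with coefficient
    [1] or [-1] in the binomials attached to sets of size [r + 1]. *)
Definition top_exponent : 'X_{1..n.+1} :=
  if (a <= n * b)%N then ext 0%MM r.+1 else ext (mesym1 [set: 'I_n]) 0.

Lemma coef0_Fform_top T : #|T| = r.+1 ->
  (Fform k a b r T)@_top_exponent@_0%MM != 0.
Proof.
move=> cT; rewrite (FformE k hb hab hJ hQ) cT ?leqnn // !mcoeffB !mcoeff_mon.
rewrite /top_exponent; case: (leqP a (n * b)) => [le_a|lt_a].
  have -> : Fsrc a b T = 0%MM.
    by apply/mnmP=> i; rewrite FsrcE mnm0E cT; have := hJ le_a; lia.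
  by rewrite !eqxx ext_eq !andbF subr0 oner_eq0.
have -> : T = [set: 'I_n].
  by apply/eqP; rewrite eqEcard subsetT cardsT card_ord cT (hQ lt_a) leqnn.
have -> : Fdst a b [set: 'I_n] = 0%MM.
  apply/mnmP=> i; rewrite FdstE mnm0E inE cardsT card_ord; lia.
by rewrite !eqxx ext_eq andbF andbF sub0r oppr_eq0 oner_eq0.
Qed.

(** The proper divisors of the top monomial have coefficient [0] in every
    relation. *)
Lemma coef0_low_degree m f :
  (m <= top_exponent)%MM -> (mdeg m <= r)%N ->
  presentation_ideal k n a b f -> f@_m@_0%MM = 0.
Proof.
move=> /mnm_lepP le_m le_r; apply: coef0_presentation_ideal => u al c edeg.
rewrite /ekey /= => /mnmP eimg.
have {}eimg i :
    (u i + al i * a + b * c = m (lift ord_max i) * a + b * m ord_max)%N.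
  by have := eimg i; rewrite !imgE mnm0E mnmE.
have em := ext_surj m; have emdeg := mdeg_ext
  [multinom m (lift ord_max i) | i < n] (m ord_max).
rewrite -em in emdeg.
move: le_m; rewrite /top_exponent; case: (leqP a (n * b)) => [le_a|lt_a] le_m.
  have hr := red_bound hb hab hJ hQ.
  have m0 i : m (lift ord_max i) = 0%N.
    by have := le_m (lift ord_max i); rewrite ext_lift mnm0E; lia.
  have mmax : m ord_max = mdeg m.
    by rewrite emdeg mdegE big1 // => i _; rewrite mnmE m0.
  have al0 i : al i = 0%N.
    have := eimg i; rewrite m0 mmax; case: (al i) => // p.
    have : (b * mdeg m <= r * b)%N by nia.
    by nia.
  have al00 : al = 0%MM by apply/mnmP=> i; rewrite al0 mnm0E.
  move: edeg; rewrite al00 mdeg0 add0n => ec.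
  split.
    by apply/mnmP=> i; have := eimg i; rewrite al0 m0 mmax mnm0E; lia.
  by apply: extP => [i|]; rewrite ?ext_lift ?ext_max ?mnm0E ?m0 ?mmax.
have mmax : m ord_max = 0%N by have := le_m ord_max; rewrite ext_max; lia.
have [i /eqP mi0] : exists i, m (lift ord_max i) == 0%N.
  have lt_mn : (mdeg m < n)%N by have := hQ lt_a; lia.
  apply/existsP; apply: contraLR lt_mn => /existsPn m_gt0.
  rewrite -leqNgt emdeg mmax addn0 mdegE -{1}(card_ord n) -sum1_card.
  by apply: leq_sum => i _; rewrite mnmE lt0n m_gt0.
have c0 : c = 0%N by have := eimg i; rewrite mi0 mmax; nia.
have eal : al = [multinom m (lift ord_max i) | i < n].
  apply/eqP; apply: contraT => ne.
  have [|j] := multinom_gt_exists _ ne; first by lia.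
  by rewrite mnmE; have := eimg j; rewrite c0 mmax; nia.
split.
  by apply/mnmP=> j; have := eimg j; rewrite c0 mmax eal mnmE mnm0E; lia.
by rewrite [RHS]em eal c0 mmax.
Qed.

(** A homogeneous generating set of degrees at most [r] would lie in the ideal
    of those polynomials whose coefficients at the divisors of the top monomial
    have no constant term, whereas the binomials of degree [r + 1] do not. *)
Lemma relation_type_presentation G0 T :
  (forall g, g \in G0 -> exists2 d, (d <= r.+1)%N & g \is d.-homog) ->
  generates (presentation_ideal k n a b) G0 -> #|T| = r.+1 ->
  relation_type (presentation_ideal k n a b) r.+1.
Proof.
move=> homG0 genG0 cT; split.
  apply: min_homog_gens_exists genG0 => g /homG0[d _ hom]; by exists d.
move=> G minG; have leG := min_homog_gens_degree homG0 genG0 minG.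
apply/eqP; rewrite eqn_leq; apply/andP; split.
  by apply/bigmax_leqP_seq => g gG _; apply: leG.
rewrite leqNgt; apply/negP=> ltG.
have {leG} ltG g : g \in G -> (ext_degree g <= r)%N.
  by move=> gG; rewrite -ltnS; apply: leq_ltn_trans ltG; apply: leq_bigmax_seq.
have [homG genG _] := minG.
pose P (c : polyR k n) := c@_0%MM = 0.
have idP : is_ideal P.
  rewrite /P; split=> [|f g e1 e2|c f e]; first by rewrite mcoeff0.
    by rewrite mcoeffD e1 e2 addr0.
  by rewrite rmorphM /= e mulr0.
have GP g : g \in G -> forall m, (m <= top_exponent)%MM -> P g@_m.
  move=> gG m le_m; rewrite /P.
  have [e|ne] := eqVneq (mdeg m) (ext_degree g).
    apply: coef0_low_degree => //; first by rewrite e ltG.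
    by apply/genG; apply: mem_ideal_gen.
  have [d hom_g] := homG _ gG.
  by rewrite (dhomog_nemf_coeff (dhomog_msize hom_g) ne) mcoeff0.
have hT : (0 < #|T| <= r.+1)%N by rewrite cT leqnn.
have /genG := Fform_in_kernel k hb hab hJ hQ hT.
move=> /(ideal_gen_min (divisor_coef_ideal top_exponent idP) GP).
by move=> /(_ _ (lepm_refl _))/eqP; apply/negP; apply: coef0_Fform_top.
Qed.

End LowDegree.

(** * Quasi-homogeneity, distinctness and number of the generators *)

Section Binomials.
Local Open Scope ring_scope.
Variables (k : fieldType) (n a b : nat).
Implicit Types (u v m al be : 'X_{1..n}) (i j : 'I_n) (T : {set 'I_n}).

Lemma binomial_poly_mon u al c v be d : ext al c != ext be d ->
  binomial_poly (mon k u al c - mon k v be d).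
Proof.
move=> ne; exists u, v, (ext al c), (ext be d); split=> //.
by apply: contraNneq ne => /(congr1 snd) /= ->.
Qed.

(** The weights of the [y_i] and of [w]. *)
Definition ywt := (if a <= n * b then 1 else a - n * b + 1)%N.
Definition wwt := (if a <= n * b then n * b - a + 1 else 1)%N.

Lemma quasi_weight_ext al c :
  (\sum_(j < n.+1) ext al c j * quasi_weight a b j = mdeg al * ywt + c * wwt)%N.
Proof.
rewrite big_ord_last /= ext_max /quasi_weight unlift_none; congr (_ + _)%N.
rewrite mdegE big_distrl /=; apply: eq_bigr => i _.
by rewrite ext_lift liftK.
Qed.

Lemma quasi_homogeneous_mon u al c v be d :
  (mdeg u + (mdeg al * ywt + c * wwt) = mdeg v + (mdeg be * ywt + d * wwt))%N ->
  quasi_homogeneous a b (mon k u al c - mon k v be d).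
Proof.
move=> e; exists (mdeg u + (mdeg al * ywt + c * wwt))%N => m' m.
rewrite !mcoeffB !mcoeff_mon.
case: (boolP ((u == m) && _)) => [/andP[/eqP <- /eqP <-]|_].
  by rewrite quasi_weight_ext.
case: (boolP ((v == m) && _)) => [/andP[/eqP <- /eqP <-]|_].
  by rewrite quasi_weight_ext e.
by rewrite subrr eqxx.
Qed.

Lemma quasi_homogeneous_koszul i j : quasi_homogeneous a b (koszul k a i j).
Proof.
by rewrite koszulE; apply: quasi_homogeneous_mon; rewrite !mdegMn !mdeg1.
Qed.

Lemma card_koszul_pairs : #|[pred p : 'I_n * 'I_n | (p.1 < p.2)%N]| = 'C(n, 2).
Proof.
rewrite -sum1_card -bin2_sum big_mkord.
rewrite (eq_bigl (fun p : 'I_n * 'I_n => true && (p.1 < p.2)%N)) //.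
rewrite -(pair_big_dep xpredT (fun i j : 'I_n => (i < j)%N)
  (fun _ _ => 1%N)) /=.
rewrite (exchange_big_dep xpredT) //=; apply: eq_bigr => j _.
by rewrite -(big_ord_widen _ (fun=> 1%N)) ?sum1_card ?card_ord // ltnW.
Qed.

Lemma eq_mnm1_muln i j :
  (0 < a)%N -> ((U_(i) *+ a)%MM == (U_(j) *+ a)%MM) = (i == j).
Proof.
move=> a0; apply/eqP/eqP=> [/mnmP /(_ i)|-> //].
by rewrite !mulmnE !mnm1E eqxx; case: eqVneq => // _; lia.
Qed.

Lemma mcoeff_koszul i j m al c :
  (koszul k a i j)@_(ext al c)@_m =
  [&& (U_(i) *+ a)%MM == m, U_(j)%MM == al & 0%N == c]%:R -
  [&& (U_(j) *+ a)%MM == m, U_(i)%MM == al & 0%N == c]%:R.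
Proof. by rewrite koszulE; apply: mcoeff_binomial. Qed.

Lemma uniq_koszul_list : (0 < a)%N -> uniq (koszul_list k n a).
Proof.
move=> a0; rewrite map_inj_in_uniq; first exact: enum_uniq.
move=> [i j] [i' j'].
rewrite !mem_enum !inE /= => lt_ij lt_ij' e.
have lij : (i == j) = false by apply: contraTF lt_ij => /eqP ->; rewrite ltnn.
have := etrans (esym (mcoeff_koszul i j _ _ _)) (etrans
  (congr1 (mcoeff (U_(i) *+ a)%MM) (congr1 (mcoeff (ext U_(j)%MM 0)) e))
  (mcoeff_koszul i' j' _ _ _)).
rewrite !eq_mnm1 !eq_mnm1_muln // lij !andbF !andbT !eqxx subr0.
have [-> /=|_ /=] := eqVneq i' i.
  have [-> //|_ /=] := eqVneq j' j.
  by rewrite lij andbF subr0 => /eqP; rewrite oner_eq0.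
have [eji|_] := eqVneq j' i; last by rewrite subr0 => /eqP; rewrite oner_eq0.
have [eij|_] := eqVneq i' j; last by rewrite subr0 => /eqP; rewrite oner_eq0.
by move: lt_ij'; rewrite eji eij ltnNge ltnW.
Qed.

End Binomials.

Section Count.
Variables (n : nat).

Lemma card_sets_leq r :
  #|[pred T : {set 'I_n} | 0 < #|T| <= r]| = \sum_(1 <= d < r.+1) 'C(n, d).
Proof.
under eq_bigr => d _ do
  rewrite -[n in 'C(n, _)]card_ord -card_draws -sum1_card big_mkcond.
rewrite exchange_big -sum1_card big_mkcond; apply: eq_bigr => T _ /=.
under eq_bigr do rewrite inE eq_sym.
by rewrite -big_mkcond big_nat1_eq inE ltnS.
Qed.

End Count.

(** * Assembling the generators *)

Section Generators.
Local Open Scope ring_scope.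
Variables (k : fieldType) (n a b r : nat).
Hypotheses (hn : (0 < n)%N) (hb : (0 < b)%N) (hab : (2 * b < a)%N).
Hypothesis hJ : (a <= n * b)%N -> (r * b < a <= r.+1 * b)%N.
Hypothesis hQ : (n * b < a)%N -> r.+1 = n.
Implicit Types (i j : 'I_n) (T : {set 'I_n}).

Let FE T (hT : (0 < #|T| <= r.+1)%N) := FformE k hb hab hJ hQ hT.

Lemma quasi_homogeneous_Fform T : (0 < #|T| <= r.+1)%N ->
  quasi_homogeneous a b (Fform k a b r T).
Proof.
move=> hT; rewrite FE //; apply: quasi_homogeneous_mon.
rewrite /Fsrc /Fdst /ywt /wwt mdegD !mdegMn !mdeg_mesym1 mdeg0.
have -> : #|~: T| = (n - #|T|)%N.
  by rewrite -(addKn #|T| #|~: T|) cardsC card_ord.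
have : (#|T| <= n)%N by rewrite -[X in (_ <= X)%N]card_ord max_card.
by move: #|T| => d le_dn; case: leqP => [le_a|lt_a]; nia.
Qed.

Lemma binomial_poly_Fform T : (0 < #|T| <= r.+1)%N ->
  binomial_poly (Fform k a b r T).
Proof.
move=> hT; rewrite FE //; apply: binomial_poly_mon.
by rewrite ext_eq; have /andP[] := hT; case: #|T| => // d _ _; rewrite andbF.
Qed.

Lemma binomial_poly_koszul i j : (i < j)%N -> binomial_poly (koszul k a i j).
Proof.
move=> lt_ij; rewrite koszulE; apply: binomial_poly_mon.
by rewrite ext_eq eq_mnm1 andbT; apply: contraTneq lt_ij => ->; rewrite ltnn.
Qed.

Lemma mcoeff_Fform T m al c : (0 < #|T| <= r.+1)%N ->
  (Fform k a b r T)@_(ext al c)@_m =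
  [&& Fsrc a b T == m, 0%MM == al & #|T| == c]%:R -
  [&& Fdst a b T == m, mesym1 T == al & 0%N == c]%:R.
Proof. by move=> hT; rewrite FE //; apply: mcoeff_binomial. Qed.

Lemma Fform_inj T1 T2 : (0 < #|T1| <= r.+1)%N -> (0 < #|T2| <= r.+1)%N ->
  Fform k a b r T1 = Fform k a b r T2 -> T1 = T2.
Proof.
have c0 T : (0 < #|T| <= r.+1)%N -> (#|T| == 0)%N = false.
  by case/andP; case: #|T|.
move=> h1 h2 e.
have := etrans (esym (mcoeff_Fform _ _ _ h1)) (etrans
  (congr1 (mcoeff (Fdst a b T1)) (congr1 (mcoeff (ext (mesym1 T1) 0)) e))
  (mcoeff_Fform _ _ _ h2)).
rewrite (c0 _ h1) (c0 _ h2).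
rewrite !andbF !sub0r !eqxx => /oppr_inj; rewrite (inj_eq (@inj_mesym1 n)).
have [//|_] := eqVneq T2 T1.
by rewrite andbF => /eqP; rewrite oner_eq0.
Qed.

Lemma Fform_neq_koszul T i j : (0 < #|T| <= r.+1)%N ->
  Fform k a b r T != koszul k a i j.
Proof.
move=> hT; apply/eqP=> e.
have := etrans (esym (mcoeff_Fform _ _ _ hT)) (etrans
  (congr1 (mcoeff (Fsrc a b T)) (congr1 (mcoeff (ext 0%MM #|T|)) e))
  (mcoeff_koszul _ _ i j _ _ _)).
rewrite [(0 == #|T|)%N]eq_sym.
have -> : (#|T| == 0)%N = false by case/andP: hT; case: #|T|.
by rewrite !andbF !subr0 !eqxx => /eqP; rewrite oner_eq0.
Qed.

Lemma mem_koszul_list i j : (i < j)%N -> koszul k a i j \in koszul_list k n a.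
Proof. by move=> lt_ij; apply/mapP; exists (i, j); rewrite ?mem_enum. Qed.

Lemma koszul_listP g : g \in koszul_list k n a ->
  exists i j, (i < j)%N /\ g = koszul k a i j.
Proof. by case/mapP=> -[i j]; rewrite mem_enum => lt_ij ->; exists i, j. Qed.

Variable T0 : {set 'I_n}.
Hypothesis cT0 : #|T0| = r.+1.

(** All the nonempty index sets of size at most [r], and one of size
    [r + 1]. *)
Definition index_sets : seq {set 'I_n} :=
  T0 :: enum [pred T : {set 'I_n} | 0 < #|T| <= r]%N.

Definition Fform_list : seq (polyS k n) :=
  [seq Fform k a b r T | T <- index_sets].

Lemma index_sets_card T : T \in index_sets -> (0 < #|T| <= r.+1)%N.
Proof.
rewrite inE mem_enum => /predU1P[->|/andP[T_gt0 leT]].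
  by rewrite cT0 leqnn.
by rewrite T_gt0 leqW.
Qed.

Lemma uniq_generators : uniq (koszul_list k n a ++ Fform_list).
Proof.
rewrite cat_uniq uniq_koszul_list ?(leq_ltn_trans _ hab) //.
apply/and3P; split=> //.
  apply/hasPn=> _ /mapP[T /index_sets_card hT ->]; apply/negP=> /koszul_listP.
  by case=> i [j [_ /eqP]]; apply/negP/Fform_neq_koszul.
rewrite map_inj_in_uniq /=; last first.
  by move=> T1 T2 /index_sets_card h1 /index_sets_card h2; apply: Fform_inj.
by rewrite enum_uniq andbT mem_enum inE cT0 ltnn.
Qed.

Lemma generates_presentation :
  generates (presentation_ideal k n a b) (koszul_list k n a ++ Fform_list).
Proof.
set G := _ ++ _ => f; split; last first.
  move: f; apply: ideal_gen_min; first exact: rees_map_ideal.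
  move=> g; rewrite mem_cat => /orP[/koszul_listP[i [j [_ ->]]]|].
    exact: koszul_in_kernel.
  by case/mapP=> T /index_sets_card hT ->; apply: Fform_in_kernel.
pose L := ideal_gen (fun g : polyS k n => g \in G).
have idL : is_ideal L by apply: ideal_gen_ideal.
have GK i j : (i < j)%N -> L (koszul k a i j).
  by move=> lt_ij; apply: mem_ideal_gen; rewrite mem_cat mem_koszul_list.
have GF T : T \in index_sets -> L (Fform k a b r T).
  by move=> hT; apply: mem_ideal_gen; rewrite mem_cat map_f ?orbT.
have GF' T : (0 < #|T| <= r)%N -> L (Fform k a b r T).
  by move=> hT; apply: GF; rewrite inE mem_enum inE hT orbT.
have GF0 := GF T0 (mem_head _ _).
have cong := cong_img hb hab hJ hQ idL GK GF' cT0 GF0.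
move: f; apply: presentation_ideal_min => // u al c v be d edeg eimg.
have [le_dc|lt_cd] := leqP d c; first exact: cong.
by rewrite -opprB; apply: is_idealN => //; apply: cong => //; apply: ltnW.
Qed.

Lemma generators_homog g : g \in koszul_list k n a ++ Fform_list ->
  exists2 d, (d <= r.+1)%N & g \is d.-homog.
Proof.
rewrite mem_cat => /orP[/koszul_listP[i [j [_ ->]]]|].
  exists 1%N => //; rewrite koszulE; apply: rpredB.
    by have := mon_dhomog k (U_(i) *+ a)%MM U_(j)%MM 0; rewrite mdeg1.
  by have := mon_dhomog k (U_(j) *+ a)%MM U_(i)%MM 0; rewrite mdeg1.
case/mapP=> T /index_sets_card hT ->; exists #|T|; first by case/andP: hT.
rewrite FE //; apply: rpredB.
  by have := mon_dhomog k (Fsrc a b T) 0%MM #|T|; rewrite mdeg0.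
by have := mon_dhomog k (Fdst a b T) (mesym1 T) 0; rewrite mdeg_mesym1 addn0.
Qed.

End Generators.

Theorem theorem1p4 (k : fieldType) (n a b r : nat)
    (hn : 1 <= n) (hb : 0 < b) (hab : 2 * b < a)
    (hr : reduction_number (min_reduction k n a b) (idealI k n a b) r) :
  [/\ exists Fs : seq (polyS k n),
        let G := koszul_list k n a ++ Fs in
        [/\ generates (presentation_ideal k n a b) G,
            uniq G,
            size G = 'C(n, 2) + \sum_(1 <= d < r.+1) 'C(n, d) + 1
              /\ size (koszul_list k n a) = 'C(n, 2),
            forall g, g \in G -> binomial_poly g /\ quasi_homogeneous a b g
          & forall g, g \in Fs -> exists T : {set 'I_n},
              1 <= #|T| <= r.+1 /\ g = Fform k a b r T],
      (forall i j : 'I_n, i < j -> iterated_sylvester a b (koszul k a i j)) /\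
      (forall T : {set 'I_n}, 1 <= #|T| <= r.+1 ->
         iterated_sylvester a b (Fform k a b r T))
    & relation_type (presentation_ideal k n a b) r.+1].
Proof.
have [hJ hQ] := reduction_number_value hn hb hab hr.
have [T0 _ cT0] : exists2 T : {set 'I_n}, T \subset [set: 'I_n] & #|T| = r.+1.
  by apply: subset_of_card; rewrite cardsT card_ord (red_ltn hb hab hJ hQ).
have size_koszul : size (koszul_list k n a) = 'C(n, 2).
  by rewrite size_map -cardE card_koszul_pairs.
split.
- exists (Fform_list k a b r T0); split.
  + exact: generates_presentation.
  + exact: uniq_generators.
  + split=> //; rewrite size_cat size_koszul size_map /= -cardE card_sets_leq.
    by rewrite -addnA addn1.
  + move=> g; rewrite mem_cat => /orP[/koszul_listP[i [j [lt_ij ->]]]|].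
      by split; [exact: binomial_poly_koszul | exact: quasi_homogeneous_koszul].
    case/mapP=> T /(index_sets_card cT0) hT ->.
    by split; [exact: binomial_poly_Fform | exact: quasi_homogeneous_Fform].
  by move=> g /mapP[T /(index_sets_card cT0) hT ->]; exists T.
- split=> [i j|T hT]; first exact: IterKoszul.
  exact: Fform_iterated_sylvester.
exact: (relation_type_presentation hn hb hab hJ hQ
  (generators_homog hb hab hJ hQ cT0) (generates_presentation hb hab hJ hQ cT0)
  cT0).
Qed.
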